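(* Let $n\ge1$, $\sigma\in S_n$, and let $\lambda$ be a weak composition with $n$ parts, with weak standardization $\tilde\lambda$. Then \[ \frac{\mathrm{E}^\sigma_\lambda(x_1,\dots,x_n;1,t)}{\mathrm{E}^\sigma_{\tilde\lambda}(x_1,\dots,x_n;1,t)}=F_\lambda(x_1,\dots,x_n), \] where $F_\lambda$ is an elementary symmetric polynomial (i.e. of the form $e_\nu=\prod_i e_{\nu_i}$ for some partition $\nu$) independent of $t$.
   Context: Weak standardization: for a weak composition $\lambda$, $\tilde\lambda$ is the lexicographically smallest composition such that for all $i,j$: $\lambda_i\le\lambda_j$ if and only if $\tilde\lambda_i\le\tilde\lambda_j$; equivalently $\tilde\lambda_i$ is the number of distinct values among the entries of $\lambda$ that are strictly smaller than $\lambda_i$ (e.g. $(6,2,5,2,3,3)\mapsto(3,0,2,0,1,1)$). Permuted-basement Macdonald polynomials. A weak composition $\lambda=(\lambda_1,\dots,\lambda_n)$ is a vector of non-negative integers. For $\sigma\in S_n$ in one-line notation, an augmented filling of shape $\lambda$ and basement $\sigma$ is an assignment $F$ of a positive integer to each box $(r,c)$ with $1\le r\le n$, $0\le c\le\lambda_r$ (row $r$ counted from the top), with $F(r,0)=\sigma_r$; column $0$ is the basement, boxes with $c\ge1$ are non-basement boxes. Two boxes are attacking if they have equal entries and either lie in the same column, or lie in adjacent columns $c-1,c$ with the box in column $c$ in a row strictly below the other. $\mathrm{NAF}_\sigma(\lambda)$ is the set of augmented fillings with no attacking pair and non-basement entries in $\{1,\dots,n\}$. A type $A$ triple: boxes $a=(r,c-1)$,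 $b=(r,c)$, $z=(r',c)$ with $c\ge1$, $r'>r$, $\lambda_r\ge\lambda_{r'}$. A type $B$ triple: $a=(r,c-1)$, $b=(r,c)$, $z=(r',c-1)$ with $c\ge1$, $r'<r$, $\lambda_r>\lambda_{r'}$. With $A=F(a),B=F(b),C=F(z)$, comparing $(A,3),(C,2),(B,1)$ lexicographically, the triple is an inversion triple if $A<C<B$, $C<B<A$ or $B<A<C$, otherwise a coinversion triple; $\mathrm{coinv}(F)$ counts coinversion triples. For $u=(r,c)$: $\mathrm{leg}(u)=\lambda_r-c$, $\mathrm{arm}(u)=\#\{r'>r:\lambda_{r'}\le\lambda_r,\ c\le\lambda_{r'}\}+\#\{r'<r:\lambda_{r'}<\lambda_r,\ c-1\le\lambda_{r'}\}$. A descent is a non-basement box $u=(r,c)$ with $F(r,c-1)<F(r,c)$; $\mathrm{maj}(F)=\sum_{u\text{ descent}}(\mathrm{leg}(u)+1)$; $\mathbf{x}^F=\prod_{u\text{ non-basement}}x_{F(u)}$. Then \[\mathrm{E}^\sigma_\lambda(\mathbf{x};q,t)=\sum_{F\in\mathrm{NAF}_\sigma(\lambda)}\mathbf{x}^F q^{\mathrm{maj}(F)}t^{\mathrm{coinv}(F)}\prod_{\substack{u=(r,c),\,c\ge1\\ F(r,c-1)\ne F(r,c)}}\frac{1-t}{1-q^{1+\mathrm{leg}(u)}t^{1+\mathrm{arm}(u)}}.\] *)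

(* Defs.v *)
From HB Require Import structures.
From mathcomp Require Import all_boot all_order all_algebra all_fingroup.
From mathcomp Require Export mpoly.

Set Implicit Arguments.
Unset Strict Implicit.
Unset Printing Implicit Defensive.

Import Order.TTheory GRing.Theory.
Local Open Scope ring_scope.

(* Rows, entries and variables, numbered from 1 to n on paper, are indexed by
   'I_n and hence shifted down by 1; columns keep their numbers. Only the
   relative order of the entries matters, so the shift is harmless. *)

Definition weak_comp (n : nat) := {ffun 'I_n -> nat}.

Section WeakStandardization.
Variable n : nat.
Implicit Types lam mu : weak_comp n.

Definition weak_std lam : weak_comp n :=
  [ffun i => size (undup [seq lam j | j <- enum 'I_n & (lam j < lam i)%N])].

Definition same_order lam mu :=
  forall i j : 'I_n, (lam i <= lam j)%N <-> (mu i <= mu j)%N.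

Definition lex_le lam mu :=
  lam = mu \/
  exists2 i : 'I_n, forall j : 'I_n, (j < i)%N -> lam j = mu j
                  & (lam i < mu i)%N.

End WeakStandardization.

Section Fillings.
Variables (n : nat) (lam : weak_comp n).

Definition box : finType := {r : 'I_n & 'I_(lam r).+1}.

Definition row (u : box) : 'I_n := tag u.
Definition col (u : box) : nat := tagged u.

Definition basement_box (r : 'I_n) : box :=
  existT (fun r : 'I_n => 'I_(lam r).+1) r ord0.

(* Meaningful only for non-basement boxes. *)
Definition left_box (u : box) : box :=
  existT (fun r : 'I_n => 'I_(lam r).+1) (row u) (inord (col u).-1).

Definition nonbasement (u : box) : bool := (0 < col u)%N.

Definition filling := {ffun box -> 'I_n}.
Implicit Types F : filling.

Definition attacking F (u v : box) : bool :=
  [&& u != v, F u == F v &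
      (col u == col v) || ((col v == (col u).+1) && (row u < row v)%N)].

Definition NAF (sigma : 'S_n) : {set filling} :=
  [set F : filling | [forall r, F (basement_box r) == sigma r]
         & [forall u, forall v, ~~ attacking F u v]].

(* A triple (a, b, z) is represented by (b, z), as a is the box left of b. *)
Definition triple_A (b z : box) : bool :=
  [&& nonbasement b, col z == col b, (row b < row z)%N
    & (lam (row z) <= lam (row b))%N].

Definition triple_B (b z : box) : bool :=
  [&& nonbasement b, (col z).+1 == col b, (row z < row b)%N
    & (lam (row z) < lam (row b))%N].

Definition lex_lt (x y : nat * nat) : bool :=
  (x.1 < y.1)%N || ((x.1 == y.1) && (x.2 < y.2)%N).

Definition inversion_triple F (b z : box) : bool :=
  let A := (val (F (left_box b)), 3%N) in
  let C := (val (F z), 2%N) in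
  let B := (val (F b), 1%N) in
  [|| lex_lt A C && lex_lt C B, lex_lt C B && lex_lt B A
    | lex_lt B A && lex_lt A C].

Definition coinv F : nat :=
  #|[set p : box * box | (triple_A p.1 p.2 || triple_B p.1 p.2)
                         && ~~ inversion_triple F p.1 p.2]|.

Definition leg (u : box) : nat := (lam (row u) - col u)%N.

Definition arm (u : box) : nat :=
  (#|[set r : 'I_n | [&& row u < r, lam r <= lam (row u) & col u <= lam r]]| +
   #|[set r : 'I_n | [&& r < row u, lam r < lam (row u)
                       & (col u).-1 <= lam r]]|)%N.

Definition descent F (u : box) : bool :=
  nonbasement u && (F (left_box u) < F u)%N.

Definition maj F : nat := (\sum_(u | descent F u) (leg u).+1)%N.

Definition filling_monomial (K : fieldType) F : {mpoly K[n]} :=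
  \prod_(u | nonbasement u) 'X_(F u).

Definition filling_weight (K : fieldType) (q t : K) F : K :=
  q ^+ maj F * t ^+ coinv F *
  \prod_(u | nonbasement u && (F (left_box u) != F u))
     ((1 - t) / (1 - q ^+ (1 + leg u) * t ^+ (1 + arm u))).

End Fillings.

(* The parameters q and t may be any elements of K for which the denominators
   do not vanish; in particular q = 1 is allowed when t is not a root of unity,
   and the formula then gives the specialization of the polynomial over the
   field of rational functions in q and t. *)
Definition macdonald (K : fieldType) (n : nat) (sigma : 'S_n)
    (lam : weak_comp n) (q t : K) : {mpoly K[n]} :=
  \sum_(F in NAF lam sigma) filling_weight q t F *: filling_monomial K F.

Definition Qt : fieldType := {fraction {poly rat}}.
Definition tvar : Qt := tofrac ('X : {poly rat}).

Definition is_partition (nu : seq nat) : bool :=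
  sorted geq nu && (0%N \notin nu).

Definition elementary (n : nat) (R : comNzRingType) (nu : seq nat) :
    {mpoly R[n]} :=
  \prod_(k <- nu) mesym n R k.

Lemma weak_std_same_order (n : nat) (lam : weak_comp n) :
  same_order lam (weak_std lam).
Proof.
pose S i := undup [seq lam j | j <- enum 'I_n & (lam j < lam i)%N].
have memS i v : (v \in S i) = (v \in codom lam) && (v < lam i)%N.
  rewrite mem_undup; apply/mapP/andP => [[j]|[/codomP[j ->] lt_ji]].
    by rewrite mem_filter => /andP[lt_ji _] ->; rewrite codom_f.
  by exists j; rewrite // mem_filter lt_ji mem_enum.
have leS i j : (lam i <= lam j)%N -> (size (S i) <= size (S j))%N.
  move=> le_ij; apply: uniq_leq_size; first exact: undup_uniq.
  by move=> v; rewrite !memS => /andP[-> /leq_trans->].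
move=> i j; rewrite !ffunE -/(S i) -/(S j); split; first exact: leS.
apply: contraTT; rewrite -!ltnNge => lt_ji.
have : (size (lam j :: S j) <= size (S i))%N; last by [].
apply: uniq_leq_size; first by rewrite /= undup_uniq memS ltnn andbF.
move=> v; rewrite inE memS => /orP[/eqP->|/andP[vP lt_vj]]; rewrite memS.
  by rewrite lt_ji andbT; exact: codom_f.
by rewrite vP (ltn_trans lt_vj).
Qed.

Lemma weak_std_min (n : nat) (lam mu : weak_comp n) :
  same_order lam mu -> forall i, (weak_std lam i <= mu i)%N.
Proof.
move=> so i; rewrite ffunE -[leqRHS](size_iota 0).
have eqmu j k : lam j = lam k -> mu j = mu k.
  move=> e; apply/eqP; rewrite eqn_leq.
  by apply/andP; split; apply/so; rewrite e.
pose f v := if [pick j | lam j == v] is Some j then mu j else 0%N.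
have fE j : f (lam j) = mu j.
  rewrite /f; case: pickP => [k /eqP /eqmu //|/(_ j)].
  by rewrite eqxx.
rewrite -(size_map f); apply: uniq_leq_size.
  rewrite map_inj_in_uniq ?undup_uniq // => v w.
  rewrite !mem_undup => /mapP[j _ ->] /mapP[k _ ->]; rewrite !fE => e.
  by apply/eqP; rewrite eqn_leq; apply/andP; split; apply/so; rewrite e.
move=> v /mapP[w]; rewrite mem_undup => /mapP[j jP ->] ->.
rewrite fE mem_iota add0n /= ltnNge; apply/negP => /so.
by rewrite leqNgt; move: jP; rewrite mem_filter => /andP[-> _].
Qed.

(* [weak_std lam] is the lexicographically smallest composition ordered in the
   same way as [lam]. *)
Lemma weak_std_lex_min (n : nat) (lam mu : weak_comp n) :
  same_order lam mu -> lex_le (weak_std lam) mu.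
Proof.
move=> /weak_std_min le_mu.
have [->|ne] := eqVneq (weak_std lam) mu; first by left.
right; have [i0 Pi0] : exists i, weak_std lam i != mu i.
  apply/existsP; apply: contraNT ne; rewrite negb_exists => /forallP e.
  by apply/eqP/ffunP => i; apply/eqP; rewrite -[_ == _]negbK e.
case: (@arg_minnP _ i0 (fun i => weak_std lam i != mu i) val Pi0) => i Pi imin.
exists i => [j lt_ji|]; last by rewrite ltn_neqAle Pi le_mu.
by apply/eqP; apply: contraTT lt_ji => /imin; rewrite -leqNgt.
Qed.

Lemma tvar_denominator (k : nat) : 1 - 1 * tvar ^+ k.+1 != 0.
Proof.
rewrite mul1r subr_eq0 -rmorphXn -(rmorph1 (@tofrac {poly rat})) tofrac_eq.
apply/eqP => /(congr1 (fun p : {poly rat} => size p)).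
by rewrite size_polyXn size_poly1.
Qed.

(* Main.v *)
Require Import Defs.
From mathcomp Require Import all_boot all_order all_algebra all_fingroup.
From mathcomp Require Import ring zify.

(** At q = 1 the weight of a filling is a product over its boxes, each factor
    depending only on the entry of the box, the entry to its left, and the
    entries completing a triple with these two. Filling the boxes column by
    column, from bottom to top, the bottom row therefore acquires one entry and
    can then be moved to the top, one box shorter; a bottom row without boxes
    left can be removed. This recursion is sensitive only to the order of the
    rows by length, where among rows of equal length the upper one counts as the
    larger, and it respects that order. The key claim is that lengthening the k
    largest rows by one box multiplies the polynomial by e_k. The recursion
    reduces the claim to the case where all rows are lengthened and the bottom
    row has no box; an exchange relation between adjacent rows then brings a
    nonempty row to the bottom, and if all rows are empty one sums directly.
    Every composition arises from its weak standardization by such lengthenings.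
    The denominator is nonzero since it is positive at x = (1, ..., 1),
    t = 1/2. *)

Set Implicit Arguments.
Unset Strict Implicit.
Unset Printing Implicit Defensive.

Import Order.TTheory GRing.Theory Num.Theory.
Local Open Scope ring_scope.

Local Notation row := Defs.row.
Local Notation col := Defs.col.

(** * The recursion on queues of rows at q = 1 *)

Section Queue.
Variables (n : nat) (K : fieldType) (t : K).
Hypothesis t_neq0 : t != 0.
Hypothesis denom_neq0 : forall k, 1 - t ^+ k.+1 != 0.
Implicit Types (a u v w : 'I_n) (B : seq 'I_n) (s p q : seq (nat * 'I_n)).

(* [c] is off the open arc from [a] to [v] in the cyclic order of the values:
   for pairwise distinct entries, the triple is a coinversion triple. *)
Definition off_arc a v (c : 'I_n) : bool :=
  ~~ [|| (a < c) && (c < v), (c < v) && (v < a) | (v < a) && (a < c)]%N.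

Definition phi a v B : K :=
  if v == a then 1 else
  (1 - t) / (1 - t ^+ (size B).+1) * t ^+ count (off_arc a v) B.

(** One strict comparison serves both types of triples: a row below the current one is already
    filled in the new column, so it is one box shorter and the weak inequality of type A becomes
    strict. *)
Definition lower l s : seq 'I_n := [seq y.2 | y <- s & (y.1 < l)%N].

Definition weight s : nat := sumn [seq y.1.+1 | y <- s].

(* A queue lists the rows from bottom to top, each as the number of boxes that
   remain to be filled and the last entry. Each step lowers [weight] by exactly
   one, so the fuel given in [queue_sum] never runs out. *)
Fixpoint fuel_queue_sum k s : {mpoly K[n]} :=
  if k is k'.+1 then
    match s with
    | [::] => 1
    | (0%N, _) :: s' => fuel_queue_sum k' s'
    | (l.+1, a) :: s' =>
        \sum_(v | v \notin unzip2 s')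
           phi a v (lower l.+1 s')
             *: ('X_v * fuel_queue_sum k' (rcons s' (l, v)))
    end
  else 1.

Definition queue_sum s := fuel_queue_sum (weight s) s.

Lemma queue_sum_drop a s : queue_sum ((0%N, a) :: s) = queue_sum s.
Proof. by []. Qed.

Lemma weight_rcons s l v : weight (rcons s (l, v)) = (l.+1 + weight s)%N.
Proof. by rewrite /weight map_rcons sumn_rcons addnC. Qed.

Lemma queue_sum_rotate l a s :
  queue_sum ((l.+1, a) :: s) =
  \sum_(v | v \notin unzip2 s)
     phi a v (lower l.+1 s) *: ('X_v * queue_sum (rcons s (l, v))).
Proof.
rewrite {1}/queue_sum (_ : weight _ = (l.+1 + weight s).+1) //=.
by apply: eq_bigr => v _; rewrite /queue_sum weight_rcons.
Qed.

(** * Exchange identities between the box factors *)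

Lemma phi_perm a v B B' : perm_eq B B' -> phi a v B = phi a v B'.
Proof. by move=> e; rewrite /phi (perm_size e) (seq.permP e). Qed.

Definition above a B : nat := count (fun c : 'I_n => (a < c)%N) B.

(* Apart from the ascent term, the statistic is a difference of a function of
   [v] and the same function of [a]; these factors cancel from the exchange
   identities below, leaving identities in powers of [t] alone. *)
Lemma count_off_arc a v B : a \notin B -> v \notin B -> v != a ->
  (count (off_arc a v) B + above a B =
   size B * (a < v) + above v B)%N.
Proof.
move=> + + ne; elim: B => //= c B IH; rewrite !inE.
move=> /norP[nac /IH{}IH] /norP[nvc /IH{}IH].
have: (off_arc a v c + (a < c) = (a < v) + (v < c))%N.
  move: ne nac nvc; rewrite -!val_eqE /off_arc /=.
  by case: (ltngtP a c); case: (ltngtP c v); case: (ltngtP a v) => //=; lia.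
lia.
Qed.

Definition base_phi a v (y : K) : K :=
  if v == a then 1 else (1 - t) / (1 - t * y) * (if (a < v)%N then y else 1).

Lemma phi_base a v B : a \notin B -> v \notin B ->
  phi a v B = base_phi a v (t ^+ size B)
              * (t ^+ above v B / t ^+ above a B).
Proof.
move=> na nv; rewrite /phi /base_phi; case: eqVneq => [->|ne].
  by rewrite divff ?mulr1 // expf_neq0.
rewrite -exprS -[RHS]mulrA; congr (_ * _); rewrite mulrA.
apply: (canRL (mulfK _)); first exact: expf_neq0.
rewrite -exprD count_off_arc // exprD; case: (a < v)%N.
  by rewrite muln1.
by rewrite muln0 expr0.
Qed.

Lemma phi_cons a v c B : phi a v (c :: B) =
  if v == a then 1 else
  (1 - t) / (1 - t * (t * t ^+ size B)) * t ^+ off_arc a v c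
     * t ^+ count (off_arc a v) B.
Proof.
rewrite /phi; case: eqP => // _; rewrite [count _ _]/= [size _]/= 2!exprS.
by rewrite exprD -[RHS]mulrA.
Qed.

(** The denominators depend only on the sizes of the lists; the exponents agree by the cocycle
    relation for the cyclic orientation of the triples among four values. *)
Lemma phi_exchange a v u w B C : uniq [:: a; u; w] -> v != u -> v != w ->
  phi a v (u :: B) * phi w u (v :: C) = phi w u (a :: C) * phi a v (w :: B).
Proof.
rewrite /= !inE !negb_or !andbT => /andP[/andP[nau naw] nuw] nvu nvw.
rewrite !phi_cons; case: (eqVneq v a) => [->|nva].
  by rewrite mulrC.
rewrite (negPf nuw).
have e : (off_arc a v u + off_arc w u v = off_arc w u a + off_arc a v w)%N.
  move: nau naw nuw nvu nvw nva; rewrite -!val_eqE /off_arc /=.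
  case: (ltngtP a u); case: (ltngtP w u); case: (ltngtP a v);
  case: (ltngtP u v); case: (ltngtP w a); case: (ltngtP w v) => //=; lia.
have /(congr1 (GRing.exp t)) := e; rewrite !exprD => et.
by ring: et.
Qed.

(** The entry [c] is kept apart because it takes part in the exchange; [y] stands for [t] to the
    number of the remaining entries. *)
Definition base_phi_cons a v c (y : K) : K :=
  if v == a then 1 else
  (1 - t) / (1 - t * (t * y)) * t ^+ off_arc a v c
    * (if (a < v)%N then y else 1).

Lemma phi_base_cons a v c B : a \notin B -> v \notin B ->
  phi a v (c :: B) = base_phi_cons a v c (t ^+ size B)
              * (t ^+ above v B / t ^+ above a B).
Proof.
move=> na nv; rewrite phi_cons /base_phi_cons; case: eqVneq => [->|ne].
  by rewrite divff ?mulr1 // expf_neq0.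
rewrite -[RHS]mulrA; congr (_ * _); rewrite mulrA.
apply: (canRL (mulfK _)); first exact: expf_neq0.
rewrite -exprD count_off_arc // exprD; case: (a < v)%N.
  by rewrite muln1.
by rewrite muln0 expr0.
Qed.

Lemma base_four_term u w v1 v2 (ys yb : K) : u != w -> v1 != v2 ->
  1 - t * ys != 0 -> 1 - t * yb != 0 -> 1 - t * (t * (ys * yb)) != 0 ->
  (v2 != w)%:R * base_phi u v2 ys * base_phi_cons w v1 v2 (ys * yb)
  + (v1 != w)%:R * base_phi u v1 ys * base_phi_cons w v2 v1 (ys * yb)
     * base_phi v2 v1 yb
  = (v1 != u)%:R * base_phi_cons w v1 u (ys * yb) * base_phi u v2 ys
  + base_phi w u yb * ((v1 != w)%:R * base_phi_cons u v1 w (ys * yb)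
     * base_phi w v2 ys).
Proof.
move=> nuw nv12 ds db dl.
rewrite /base_phi /base_phi_cons /off_arc.
move: nuw nv12; rewrite -!val_eqE /=.
case: (ltngtP u w) => // uw _; case: (ltngtP v1 v2) => // v12 _;
case: (ltngtP u v1) => uv1; case: (ltngtP u v2) => uv2;
case: (ltngtP w v1) => wv1; case: (ltngtP w v2) => wv2 /=;
try (exfalso; lia);
rewrite ?mul1r ?mul0r ?add0r ?addr0 ?mulr0 ?expr0 ?expr1 ?mulr1 //;
by field; rewrite ?ds ?db ?dl.
Qed.

Lemma size_denom_neq0 B : 1 - t * t ^+ size B != 0.
Proof. by rewrite -exprS. Qed.

(** Compares coefficients when two nonempty rows ending in [u] and [w] reach the front and receive
    the entries [v1] and [v2]. Up to a common factor only the relative order of the four values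
    matters, and each order gives a rational identity in [t] and two of its powers. *)
Lemma phi_four_term u w v1 v2 BS Bb : u != w -> v1 != v2 ->
  {in BS ++ Bb, forall c, c \notin [:: u; w; v1; v2]} ->
  let BL := BS ++ Bb in
  (v2 != w)%:R * phi u v2 BS * phi w v1 (v2 :: BL)
  + (v1 != w)%:R * phi u v1 BS * phi w v2 (v1 :: BL) * phi v2 v1 Bb
  = (v1 != u)%:R * phi w v1 (u :: BL) * phi u v2 BS
  + phi w u Bb * ((v1 != w)%:R * phi u v1 (w :: BL) * phi w v2 BS).
Proof.
move=> nuw nv12 out BL.
have outL x : x \in [:: u; w; v1; v2] -> x \notin BL.
  by move=> xin; apply: contraL xin => /out.
have outS x : x \in [:: u; w; v1; v2] -> x \notin BS.
  by move=> /outL; rewrite mem_cat => /norP[].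
have outb x : x \in [:: u; w; v1; v2] -> x \notin Bb.
  by move=> /outL; rewrite mem_cat => /norP[].
have [iu iw i1 i2] : [/\ u \in [:: u; w; v1; v2], w \in [:: u; w; v1; v2],
    v1 \in [:: u; w; v1; v2] & v2 \in [:: u; w; v1; v2]].
  by rewrite !inE !eqxx !orbT.
rewrite !phi_base_cons ?outL // !phi_base ?outS ?outb //.
have aboveL x : t ^+ above x BL = t ^+ above x BS * t ^+ above x Bb.
  by rewrite /above count_cat exprD.
rewrite !aboveL size_cat exprD.
have ds := size_denom_neq0 BS; have db := size_denom_neq0 Bb.
have := size_denom_neq0 (u :: BL); rewrite /= exprS size_cat exprD => dl.
have := base_four_term nuw nv12 ds db dl.
have nz x B : t ^+ above x B != 0 by apply: expf_neq0.
move: (nz u BS) (nz w BS) (nz v1 BS) (nz v2 BS).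
move: (nz u Bb) (nz w Bb) (nz v1 Bb) (nz v2 Bb).
move: (t ^+ above u BS) (t ^+ above w BS) (t ^+ above v1 BS) (t ^+ above v2 BS).
move: (t ^+ above u Bb) (t ^+ above w Bb) (t ^+ above v1 Bb) (t ^+ above v2 Bb).
move=> ub wb v1b v2b us ws v1s v2s ub0 wb0 v1b0 v2b0 us0 ws0 v1s0 v2s0 e.
(* All four products carry this factor, so the claim is a multiple of [base_four_term]. *)
pose c := v1s * v2s * v1b / (us * ws * wb).
transitivity
  (((v2 != w)%:R * base_phi u v2 (t ^+ size BS)
       * base_phi_cons w v1 v2 (t ^+ size BS * t ^+ size Bb)
    + (v1 != w)%:R * base_phi u v1 (t ^+ size BS)
       * base_phi_cons w v2 v1 (t ^+ size BS * t ^+ size Bb)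
       * base_phi v2 v1 (t ^+ size Bb)) * c).
  by rewrite /c; field; rewrite ?us0 ?ws0 ?wb0 ?v2b0.
by rewrite e /c; field; rewrite ?us0 ?ws0 ?wb0 ?ub0.
Qed.

(* The rows strictly between two adjacent rows of lengths l (below) and l'
   (above), in the order by length in which ties are won by the upper row. *)
Definition between l l' p q : seq 'I_n :=
  [seq y.2 | y <- p & (l < y.1 <= l')%N]
    ++ [seq y.2 | y <- q & (l <= y.1 < l')%N].

(** * The exchange relation between adjacent rows *)

Lemma unzip2_cat p q : unzip2 (p ++ q) = unzip2 p ++ unzip2 q.
Proof. exact: map_cat. Qed.

Lemma lower_cat l p q : lower l (p ++ q) = lower l p ++ lower l q.
Proof. by rewrite /lower filter_cat map_cat. Qed.

Lemma lower_cons l y q :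
  lower l (y :: q) = if (y.1 < l)%N then y.2 :: lower l q else lower l q.
Proof. by rewrite /lower /=; case: ifP. Qed.

Lemma perm_move (T : eqType) (r1 : seq T) (x : T) (r2 : seq T) :
  perm_eq (r1 ++ x :: r2) (x :: r1 ++ r2).
Proof. by rewrite -cat1s perm_catCA. Qed.

(** The first term on the right moves the entries along with the lengths, the second leaves them in
    place; either way the longer row ends up below if [l < l']. The coefficient is that of a box
    with entry [u] to the right of [w], with triples formed by the rows of intermediate size
    only. *)
Definition swap_holds l l' u w p q :=
  queue_sum (p ++ (l, u) :: (l', w) :: q) =
  queue_sum (p ++ (l', w) :: (l, u) :: q)
  + phi w u (between l l' p q) *: queue_sum (p ++ (l', u) :: (l, w) :: q).

(** Filling a box in a row below the two changes [between] only if that row has intermediate size;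
    its entry [a] then gives way to [v], and [phi_exchange] absorbs the change. *)
Lemma queue_sum_swap_inner l l' u w a k p q : (l < l')%N ->
  uniq (unzip2 ((k.+1, a) :: p ++ (l, u) :: (l', w) :: q)) ->
  (forall v, v \notin unzip2 (p ++ (l, u) :: (l', w) :: q) ->
     swap_holds l l' u w p (rcons q (k, v))) ->
  swap_holds l l' u w ((k.+1, a) :: p) q.
Proof.
move=> lt_l U IH; rewrite /swap_holds !cat_cons !queue_sum_rotate.
have e1 : unzip2 (p ++ (l', w) :: (l, u) :: q)
            =i unzip2 (p ++ (l, u) :: (l', w) :: q).
  apply: perm_mem; rewrite !unzip2_cat perm_cat2l /=.
  by rewrite -(cat1s w) -(cat1s u) perm_catCA.
have e2 : unzip2 (p ++ (l', u) :: (l, w) :: q)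
            = unzip2 (p ++ (l, u) :: (l', w) :: q).
  by rewrite !unzip2_cat.
rewrite e2 [X in _ = X + _](eq_bigl _ _ (fun v => congr1 negb (e1 v))).
rewrite scaler_sumr -big_split; apply: eq_bigr => v nv.
rewrite !rcons_cat !rcons_cons /= IH //.
have -> : phi a v (lower k.+1 (p ++ (l', w) :: (l, u) :: q)) =
          phi a v (lower k.+1 (p ++ (l, u) :: (l', w) :: q)).
  apply: phi_perm; rewrite !lower_cat !lower_cons perm_cat2l /=.
  case: ifP => _; case: ifP => _ //.
  by rewrite -(cat1s w) -(cat1s u) perm_catCA.
rewrite mulrDr scalerDr; congr (_ + _); rewrite -scalerAr !scalerA.
congr (_ *: _).
have btw1 : between l l' p (rcons q (k, v)) =
   if (l <= k < l')%N then rcons (between l l' p q) v else between l l' p q.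
  rewrite /between filter_rcons /=; case: ifP => _ //.
  by rewrite map_rcons rcons_cat.
have btw2 : between l l' ((k.+1, a) :: p) q =
   if (l <= k < l')%N then a :: between l l' p q else between l l' p q.
  by rewrite /between /= ltnS; case: ifP.
rewrite btw1 btw2 !lower_cat !lower_cons /= !ltnS.
(* If [k < l], neither of the two rows enters [lower]; if [l' <= k], both do. Only in between does
   it matter which of [u] and [w] the shorter row carries. *)
case: (leqP l k) => /= lk; last first.
  rewrite leqNgt (ltn_trans lk lt_l) /=.
  by rewrite mulrC.
case: (ltnP k l') => /= kl; last first.
  by rewrite mulrC.
have [nau naw nuw] : [/\ a != u, a != w & u != w].
  move: U; rewrite /= unzip2_cat mem_cat cat_uniq /= !inE !negb_or.
  by case/andP=> /and4P[_ -> -> _] /and3P[_ _ /andP[/andP[->]]].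
have [nvu nvw] : v != u /\ v != w.
  by move: nv; rewrite unzip2_cat mem_cat /= !inE !negb_or => /and4P[].
rewrite (phi_perm a v (perm_move _ _ _)) (phi_perm a v (perm_move _ w _)).
rewrite (@phi_perm w u _ (v :: between l l' p q)) ?perm_rcons //.
by rewrite phi_exchange //= !inE !negb_or nau naw nuw.
Qed.

Lemma sum_notin_cons (r : seq 'I_n) u (G : 'I_n -> {mpoly K[n]}) :
  \sum_(v | v \notin u :: r) G v = \sum_(v | v \notin r) (v != u)%:R *: G v.
Proof.
rewrite big_mkcond [RHS]big_mkcond; apply: eq_bigr => v _.
by rewrite inE; case: (v \in r); case: eqP => //=; rewrite ?scale0r ?scale1r.
Qed.

Lemma sum_notin_rcons (r : seq 'I_n) u (G : 'I_n -> {mpoly K[n]}) :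
  \sum_(v | v \notin rcons r u) G v
    = \sum_(v | v \notin r) (v != u)%:R *: G v.
Proof.
by rewrite -sum_notin_cons; apply: eq_bigl => v; rewrite mem_rcons.
Qed.

(** The coefficient identity for an empty row under the longer one: on the left of the exchange
    relation it is dropped before the box is filled, on the right it still forms a triple with that
    box. *)
Lemma phi_split u w v B : u != w ->
  {in B, forall c, c \notin [:: u; w; v]} ->
  phi w v B = (v != u)%:R * phi w v (u :: B)
              + phi w u B * ((v != w)%:R * phi u v (w :: B)).
Proof.
move=> nuw out.
have outB x : x \in [:: u; w; v] -> x \notin B.
  by move=> xin; apply: contraL xin => /out.
rewrite !phi_base_cons ?outB ?inE ?eqxx ?orbT //.
rewrite !phi_base ?outB ?inE ?eqxx ?orbT //.
have nz x : t ^+ above x B != 0 by apply: expf_neq0.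
have ds := size_denom_neq0 B; have := size_denom_neq0 (u :: B).
rewrite /= exprS; move: ds.
move: (t ^+ above u B) (t ^+ above w B) (t ^+ above v B) (nz u) (nz w) (nz v).
move: (t ^+ size B) => y fu fw fv fu0 fw0 fv0 d1 d2.
rewrite /base_phi /base_phi_cons /off_arc -!val_eqE /=.
move: nuw; rewrite -!val_eqE /=.
case: (ltngtP u w) => // uw _; case: (ltngtP u v) => uv; 
case: (ltngtP w v) => wv /=; try (exfalso; lia).
all: rewrite ?mul1r ?mul0r ?add0r ?addr0 ?mulr0 ?expr0 ?expr1 ?mulr1 //.
all: by field; rewrite ?fu0 ?fw0 ?d1 ?d2.
Qed.

Lemma queue_sum_swap_front0 l' u w q :
  uniq (unzip2 ((0%N, u) :: (l'.+1, w) :: q)) ->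
  swap_holds 0 l'.+1 u w [::] q.
Proof.
rewrite /swap_holds /= => U.
rewrite queue_sum_drop !queue_sum_rotate /= !lower_cons /=.
rewrite !sum_notin_cons scaler_sumr -big_split; apply: eq_bigr => v nv.
rewrite /= queue_sum_drop !scalerA -scalerDl; congr (_ *: _).
have -> : between 0 l'.+1 [::] q = lower l'.+1 q by [].
rewrite -[_ * _ * phi u v _]mulrA; apply: phi_split.
  by move: U; rewrite /= !inE !negb_or => /andP[/andP[]].
move=> c; rewrite /lower => cq; have {}cq : c \in unzip2 q.
  by case/mapP: cq => y; rewrite mem_filter => /andP[_ yq] ->; rewrite map_f.
move: U nv; rewrite /= !inE !negb_or => /and3P[/andP[_ nuq] nwq _] nvq.
have ne x : x \notin unzip2 q -> c != x by apply: contraNneq => <-.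
by rewrite !ne.
Qed.

(** Both rows are filled in turn. On the left they then stand at the back with the shorter one
    below, so the relation applies to their new entries; on the right the longer one is already
    below. The coefficients agree by [phi_four_term]. *)
Lemma queue_sum_swap_front l l' u w q : (l < l')%N ->
  uniq (unzip2 ((l.+1, u) :: (l'.+1, w) :: q)) ->
  (forall v1 v2, uniq (unzip2 (q ++ [:: (l, v2); (l', v1)])) ->
     swap_holds l l' v2 v1 q [::]) ->
  swap_holds l.+1 l'.+1 u w [::] q.
Proof.
move=> lt_l U IH; rewrite /swap_holds /=.
have rot2 k k' x y : queue_sum ((k.+1, x) :: (k'.+1, y) :: q) =
  \sum_(v | v \notin unzip2 q) \sum_(v' | v' \notin unzip2 q)
    ((v' != v)%:R * (v != y)%:R
      * phi x v (lower k.+1 ((k'.+1, y) :: q))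
      * phi y v' (lower k'.+1 (rcons q (k, v))))
      *: ('X_v * 'X_v' * queue_sum (q ++ [:: (k, v); (k', v')])).
  rewrite queue_sum_rotate /= sum_notin_cons; apply: eq_bigr => v nv.
  rewrite queue_sum_rotate /unzip2 map_rcons sum_notin_rcons.
  rewrite mulr_sumr !scaler_sumr; apply: eq_bigr => v' nv'.
  rewrite -!scalerAr !scalerA -!cats1 -catA /=.
  by congr (_ *: _); [ring | rewrite mulrA].
have nuw : u != w by move: U; rewrite /= inE negb_or => /andP[/andP[]].
have btw : between l l' q [::] = between l.+1 l'.+1 [::] q.
  by rewrite /between /= cats0.
have low1 x : lower l.+1 ((l'.+1, x) :: q) = lower l.+1 q.
  by rewrite lower_cons /= ltnS ltnNge ltnW.
have low2 x : lower l.+1 (rcons q (l', x)) = lower l.+1 q.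
  by rewrite -cats1 lower_cat /= lower_cons /= ltnS leqNgt lt_l cats0.
have low3 x : lower l'.+1 ((l.+1, x) :: q) = x :: lower l'.+1 q.
  by rewrite lower_cons /= ltnS lt_l.
have low4 x : lower l'.+1 (rcons q (l, x)) = rcons (lower l'.+1 q) x.
  by rewrite -!cats1 lower_cat /= lower_cons /= ltnS ltnW.
pose e v1 v2 := 'X_v1 * 'X_v2 * queue_sum (q ++ [:: (l', v1); (l, v2)]).
pose BS := lower l.+1 q; pose Bb := between l.+1 l'.+1 [::] q.
have perm_low : perm_eq (BS ++ Bb) (lower l'.+1 q).
  rewrite -map_cat; apply: perm_map.
  rewrite perm_sym -(perm_filterC (fun y => y.1 < l.+1)%N) -!filter_predI.
  set r := _ ++ _; set r' := _ ++ _; suff -> : r = r' by [].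
  by congr (_ ++ _); apply: eq_filter => y /=; lia.
have in_q x : x \in BS ++ Bb -> x \in unzip2 q.
  rewrite (perm_mem perm_low) => /mapP[y]; rewrite mem_filter => /andP[_ yq] ->.
  exact: map_f.
pose c v2 v1 := (v1 != v2)%:R * (v2 != w)%:R * phi u v2 BS
  * phi w v1 (v2 :: BS ++ Bb).
transitivity (\sum_(v1 | v1 \notin unzip2 q) \sum_(v2 | v2 \notin unzip2 q)
   (c v2 v1 + c v1 v2 * phi v2 v1 Bb) *: e v1 v2).
  rewrite rot2; transitivity
   (\sum_(v2 | v2 \notin unzip2 q) \sum_(v1 | v1 \notin unzip2 q)
      (c v2 v1 *: e v1 v2 + (c v2 v1 * phi v1 v2 Bb) *: e v2 v1)).
    apply: eq_bigr => v2 nv2; apply: eq_bigr => v1 nv1; rewrite low1 low4.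
    rewrite (@phi_perm w v1 _ (v2 :: BS ++ Bb)); last first.
      by rewrite perm_rcons perm_cons perm_sym.
    rewrite -/BS -/(c v2 v1); case: (eqVneq v1 v2) => [->|ne].
      by rewrite /c eqxx !mul0r !scale0r addr0.
    rewrite IH ?btw; last first.
      rewrite unzip2_cat -[unzip2 [:: _; _]]/[:: v2; v1] cat_uniq /= !inE orbF.
      rewrite negb_or nv1 nv2 eq_sym ne !andbT.
      by case/and3P: U.
    by rewrite -scalerA -scalerDr /e mulrDr [in 'X_v1 * _]mulrC scalerAr.
  transitivity 
   (\sum_(v2 | v2 \notin unzip2 q) \sum_(v1 | v1 \notin unzip2 q)
      c v2 v1 *: e v1 v2 +
    \sum_(v2 | v2 \notin unzip2 q) \sum_(v1 | v1 \notin unzip2 q)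
      (c v2 v1 * phi v1 v2 Bb) *: e v2 v1).
    by rewrite -big_split; apply: eq_bigr => v2 _; rewrite -big_split.
  (* Summations are interchanged in the first double sum only; in the second, renaming the indices
     has the same effect. *)
  rewrite exchange_big -big_split; apply: eq_bigr => v1 _.
  by rewrite -big_split; apply: eq_bigr => v2 _; rewrite scalerDl.
rewrite !rot2 scaler_sumr -big_split; apply: eq_bigr => v1 nv1.
rewrite scaler_sumr -big_split; apply: eq_bigr => v2 nv2.
rewrite /= !low3 !low2 -/BS -/Bb scalerA -scalerDl -/(e v1 v2).
congr (_ *: _).
rewrite (@phi_perm w v1 (u :: _) (u :: BS ++ Bb)) 1?perm_sym ?perm_cons //.
rewrite (@phi_perm u v1 (w :: _) (w :: BS ++ Bb)) 1?perm_sym ?perm_cons //.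
rewrite /c [v2 == v1]eq_sym; case: (eqVneq v1 v2) => [->|ne].
  by rewrite !mul0r mulr0 addr0.
rewrite !mul1r; apply: phi_four_term => // x /in_q xq.
move: U; rewrite /= !inE !negb_or => /and3P[/andP[_ nuq] nwq _].
have neq y : y \notin unzip2 q -> x != y by apply: contraNneq => <-.
by rewrite !neq.
Qed.

(** Induction on [weight]: the rows below the two are dropped or filled until the two come to the
    front; an empty shorter row there ends the recursion. *)
Lemma queue_sum_swap l l' u w p q : (l < l')%N ->
  uniq (unzip2 (p ++ (l, u) :: (l', w) :: q)) -> swap_holds l l' u w p q.
Proof.
move=> lt_l; have [k] := ubnP (weight (p ++ (l, u) :: (l', w) :: q)).
elim: k => // k IH in l l' lt_l u w p q *; rewrite ltnS => wk.
have wcat r1 r2 : weight (r1 ++ r2) = (weight r1 + weight r2)%N.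
  by rewrite /weight map_cat sumn_cat.
have wcons y r : weight (y :: r) = (y.1.+1 + weight r)%N by [].
have wnil : weight [::] = 0%N by [].
case: p wk => [|[[|j] a] p] wk U.
- case: l l' => [|l] [|l'] // in lt_l wk U *.
    exact: queue_sum_swap_front0.
  apply: queue_sum_swap_front => // v1 v2 U'; apply: IH => //.
  by move: wk; rewrite /= !(wcat, wcons, wnil) /=; lia.
- rewrite /swap_holds /= !queue_sum_drop; apply: IH => //; by case/andP: U.
apply: queue_sum_swap_inner => // v nv; apply: IH => //.
  by move: wk; rewrite !(wcat, wcons, weight_rcons) /=; lia.
case/andP: U => _; move: nv.
by rewrite -!rcons_cons -rcons_cat /unzip2 map_rcons rcons_uniq => ->.
Qed.

(** * Rows with at most one box, and elementary symmetric polynomials *)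

Lemma sum_expr_count_gt (r : seq nat) : uniq r ->
  (1 - t) * \sum_(x <- r) t ^+ count (ltn x) r = 1 - t ^+ size r.
Proof.
(* In decreasing order the exponents are 0, 1, 2, and so on, so the sum is geometric. *)
move=> ur; have: uniq (sort geq r) by rewrite sort_uniq.
have: sorted geq (sort geq r).
  by apply: sort_sorted => x y /=; rewrite leq_total.
have e : perm_eq (sort geq r) r by rewrite perm_sort.
rewrite -(perm_size e) -(perm_big _ e) /=.
rewrite (eq_bigr (fun x => t ^+ count (ltn x) (sort geq r))); last first.
  by move=> x _; rewrite (seq.permP e).
elim: (sort geq r) => [|x s IH]; first by rewrite big_nil mulr0 expr0 subrr.
rewrite /= => px /andP[xs us].
have lt_x y : y \in s -> (y < x)%N.
  move=> ys; rewrite ltn_neqAle; apply/andP; split.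
    by apply: contraNneq xs => <-.
  have tr : transitive geq by move=> a b c /= ab bc; exact: leq_trans bc ab.
  by move: px; rewrite path_sortedE // => /andP[/allP /(_ _ ys)].
rewrite big_cons /= ltnn add0n (_ : count _ s = 0%N); last first.
  apply/eqP; rewrite -leqn0 leqNgt -has_count; apply/hasPn => y /lt_x.
  by rewrite /= -leqNgt => /ltnW.
rewrite (eq_big_seq (fun y => t * t ^+ count (ltn y) s)); last first.
  by move=> y /lt_x /= ->; rewrite exprS.
rewrite -big_distrr /= mulrDr mulrCA IH ?(path_sorted px) //.
by rewrite exprS; ring.
Qed.

(** If [a] lies in [U], only [v = a] is allowed, with factor 1. Otherwise the exponent of [t] is a
    rank of [v] in the cyclic order and takes each value below [#|U|] once; the denominator
    normalizes this geometric sum. *)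
Lemma sum_phi a (U : {set 'I_n}) : U != set0 ->
  \sum_(v in U | a \notin U :\ v) phi a v (enum (U :\ v)) = 1.
Proof.
move=> nU; have [aU|naU] := boolP (a \in U).
  rewrite (big_pred1 a) => [|v]; first by rewrite /phi eqxx.
  rewrite !inE aU andbT negbK eq_sym.
  by case: eqP => [->|]; rewrite ?aU ?andbF.
(* [key] sorts the values other than [a] cyclically, starting after [a]. *)
pose key (v : 'I_n) : nat := if (a < v)%N then nat_of_ord v else (v + n)%N.
have key_inj : injective key.
  move=> v w; rewrite /key => e; apply: val_inj => /=; move: e.
  by have := ltn_ord v; have := ltn_ord w; case: ifP; case: ifP; lia.
have nea v : v \in U -> v != a by apply: contraTneq => ->.
rewrite (eq_bigl (mem U)); last first.
  by move=> v; rewrite !inE (negPf naU) !andbF andbT.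
transitivity (\sum_(v in U)
   (1 - t) / (1 - t ^+ #|U|) * t ^+ count (ltn (key v)) (map key (enum U))).
  apply: eq_bigr => v vU'; have vU : v \in U := vU'.
  rewrite /phi (negPf (nea v vU)) -cardE.
  rewrite (_ : #|U :\ v|.+1 = #|U|); last by rewrite (cardsD1 v U) vU.
  congr (_ * _ ^+ _); rewrite count_map.
  have -> : count (off_arc a v) (enum (U :\ v))
            = count (fun c => (c != v) && off_arc a v c) (enum U).
    rewrite -!size_filter /enum_mem -!filter_predI; congr size.
    by apply: eq_filter => c; rewrite /= !inE; case: (c == v); rewrite ?andbF.
  apply: eq_in_count => c; rewrite mem_enum => cU.
  have := nea v vU; have := nea c cU; rewrite /off_arc /key -!val_eqE /=.
  have := ltn_ord c; have := ltn_ord v.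
  case: (ltngtP a v); case: (ltngtP a c); case: (ltngtP c v) => //=; lia.
rewrite -big_distrr /= -(big_enum _ _ (mem U)) /=.
rewrite -(big_map key xpredT (fun x => t ^+ count (ltn x) (map key (enum U)))).
rewrite mulrAC sum_expr_count_gt ?map_inj_uniq ?enum_uniq //.
rewrite size_map -cardE divff //.
by move: nU; rewrite -card_gt0; case: #|U|.
Qed.

(** [V] holds the entries of the rows already emptied; as these have no box left, their order is
    irrelevant. *)
Fixpoint ones_sum (r : seq 'I_n) (V : {set 'I_n}) : {mpoly K[n]} :=
  if r is a :: r' then
    \sum_(v | (v \notin r') && (v \notin V))
       phi a v (enum V) *: ('X_v * ones_sum r' (v |: V))
  else 1.

Lemma queue_sum_zeros (z : seq 'I_n) : queue_sum [seq (0%N, v) | v <- z] = 1.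
Proof. by elim: z. Qed.

Lemma queue_sum_ones_zeros (r z : seq 'I_n) : uniq z ->
  queue_sum ([seq (1%N, a) | a <- r] ++ [seq (0%N, v) | v <- z])
  = ones_sum r [set x in z].
Proof.
elim: r z => [|a r IH] z uz; first exact: queue_sum_zeros.
rewrite /= queue_sum_rotate unzip2_cat.
have unz (r' : seq 'I_n) (k : nat) : unzip2 [seq (k, x) | x <- r'] = r'.
  by rewrite /unzip2 -map_comp map_id.
rewrite !unz; apply: eq_big => [v|v].
  by rewrite mem_cat negb_or inE.
rewrite mem_cat negb_or => /andP[nr nz]; congr (_ *: (_ * _)).
  apply: phi_perm; rewrite lower_cat /lower !filter_map /=.
  rewrite (eq_filter (a2 := pred0)) // filter_pred0 /=.
  rewrite (eq_filter (a2 := predT)) // filter_predT -map_comp map_id.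
  by apply: uniq_perm; rewrite ?enum_uniq // => x; rewrite mem_enum inE.
rewrite rcons_cat -map_rcons IH ?rcons_uniq ?nz //; congr ones_sum.
by apply/setP => x; rewrite !inE mem_rcons inE.
Qed.

(** Summing over [V] makes the induction on [r] close, since filling the next row adds one element
    to [V]. The case wanted later is [j = 0]. *)
Lemma sum_ones_sum (r : seq 'I_n) j : uniq r ->
  \sum_(V : {set 'I_n} | (#|V| == j) && [disjoint V & r])
     (\prod_(x in V) 'X_x) * ones_sum r V
  = mesym n K (j + size r).
Proof.
elim: r j => [|a r IH] j ur.
  rewrite addn0 /mesym; apply: eq_big => [V|V _]; last first.
    by rewrite /= mulr1.
  by rewrite disjoint_sym disjoint0 andbT.
case/andP: ur => nar ur; rewrite addnS -addSn -IH //=.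
(* The choices of [V] and of the next entry [v] with a given union [U] have
   weights of sum 1, by [sum_phi]. *)
pose P (V : {set 'I_n}) v := [&& #|V| == j, [disjoint V & a :: r],
  v \notin r & v \notin V].
pose Q (U : {set 'I_n}) v := [&& #|U| == j.+1, [disjoint U & r], v \in U
  & a \notin U :\ v].
pose G (V : {set 'I_n}) v :=
  phi a v (enum V) *: (\prod_(x in v |: V) 'X_x * ones_sum r (v |: V)).
transitivity (\sum_(V : {set 'I_n}) \sum_(v | P V v) G V v).
  rewrite big_mkcond; apply: eq_bigr => V _; rewrite /P.
  case: ifP => [/andP[-> ->]|]; last first.
    move=> /negbT; rewrite negb_and => c; rewrite big_pred0 // => v.
    by case/orP: c => /negPf->; rewrite ?andbF.
  rewrite big_distrr /=; apply: eq_bigr => v /andP[nr nV].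
  by rewrite -scalerAr mulrCA mulrA /G big_setU1.
transitivity (\sum_(U : {set 'I_n}) \sum_(v | Q U v) G (U :\ v) v).
  rewrite (exchange_big_dep xpredT) //= [RHS](exchange_big_dep xpredT) //=.
  apply: eq_bigr => v _.
  (* For fixed [v], the sets [V] without [v] correspond to the unions [U] containing [v]. *)
  rewrite (reindex_onto (fun U => U :\ v) (fun V => v |: V)) /=; last first.
    by move=> V /and4P[_ _ _ /setU1K].
  apply: eq_bigl => U; rewrite /P /Q.
  have [vU|nvU] := boolP (v \in U); last first.
    rewrite !andbF; apply/negbTE; rewrite negb_and; apply/orP; right.
    by apply: contraNneq nvU => <-; rewrite setU11.
  rewrite setD1K // eqxx andbT (cardsD1 v U) vU eqSS setD11 andbT /=.
  congr (_ && _); rewrite disjoint_sym disjoint_cons disjoint_sym.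
  have -> : [disjoint U & r] = (v \notin r) && [disjoint U :\ v & r].
    rewrite -disjointU1; apply: eq_disjoint => x; rewrite !inE.
    case: (eqVneq x v) => [->|nxv] //=.
    by transitivity (x \in U :\ v); rewrite // !inE nxv.
  by case: (a \notin _); case: [disjoint _ & _]; case: (v \notin r).
rewrite [RHS]big_mkcond; apply: eq_bigr => U _; rewrite /Q.
case: ifP => [/andP[/eqP cU ->]|]; last first.
  move=> /negbT; rewrite negb_and => c; rewrite big_pred0 // => v.
  by case/orP: c => /negPf->; rewrite ?andbF.
rewrite cU eqxx /=.
rewrite (eq_bigr (fun v => phi a v (enum (U :\ v))
   *: (\prod_(x in U) 'X_x * ones_sum r U))); last first.
  by move=> v /andP[vU _]; rewrite /G setD1K.
by rewrite -scaler_suml sum_phi ?scale1r // -card_gt0 cU.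
Qed.

Lemma queue_sum_ones (r : seq 'I_n) : uniq r ->
  queue_sum [seq (1%N, a) | a <- r] = mesym n K (size r).
Proof.
move=> ur; rewrite -[X in queue_sum X]cats0.
rewrite -[[::] in X in queue_sum X]/[seq (0%N, v) | v <- [::]].
rewrite queue_sum_ones_zeros // -[in RHS](add0n (size r)) -sum_ones_sum //.
have -> : [set x in [::]] = set0 :> {set 'I_n} by apply/setP => x; rewrite !inE.
rewrite (big_pred1 set0) => [|V]; first by rewrite big_set0 mul1r.
rewrite cards_eq0 /=; case: eqP => [->|] //=.
by rewrite disjoint_subset; apply/subsetP => x; rewrite inE.
Qed.

(* The boolean marks the rows that are lengthened by one box. *)
Definition mrow := (bool * (nat * 'I_n))%type.
Implicit Types (R : seq mrow).

(** * Lengthening the largest rows *)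

Definition add_mark (y : mrow) : nat * 'I_n := (y.1 + y.2.1, y.2.2)%N.

(* For [x] below [y]: a larger row is marked if a smaller one is. *)
Definition upper (x y : mrow) : bool :=
  ((x.2.1 <= y.2.1)%N && x.1 ==> y.1) && ((y.2.1 < x.2.1)%N && y.1 ==> x.1).

Definition factors R :=
  queue_sum (map add_mark R) = mesym n K (count fst R) * queue_sum (unzip2 R).

Definition factors_below k := forall R, (weight (unzip2 R) < k)%N ->
  uniq (unzip2 (unzip2 R)) -> pairwise upper R -> factors R.

(** The two queues move in step: by [upper], lengthening alters no comparison with the front row, so
    the factors [phi] agree. The moved row is shorter but now wins ties, so it keeps its place in
    the order and the marks stay compatible. *)
Lemma factors_rotate m l a R :
  factors_below (weight (unzip2 ((m, (l.+1, a)) :: R))) ->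
  uniq (unzip2 (unzip2 ((m, (l.+1, a)) :: R))) ->
  pairwise upper ((m, (l.+1, a)) :: R) -> factors ((m, (l.+1, a)) :: R).
Proof.
move=> IH U /andP[/allP upR pR].
rewrite /factors /= {1}/add_mark /= addnS !queue_sum_rotate.
have vals : unzip2 (map add_mark R) = unzip2 (unzip2 R).
  by rewrite /unzip2 -!map_comp.
rewrite vals mulr_sumr; apply: eq_bigr => v nv.
rewrite -scalerAr mulrCA; congr (_ *: (_ * _)).
  congr phi; rewrite /lower /unzip2 !filter_map -!map_comp /=.
  congr map; apply: eq_in_filter => y /upR.
  rewrite /upper /add_mark /= => /andP[/implyP u1 /implyP u2].
  by move: u1 u2; case: (m); case: (y.1) => /=; lia.
have -> : rcons (map add_mark R) (m + l, v)%N
          = map add_mark (rcons R (m, (l, v))).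
  by rewrite map_rcons.
have -> : rcons (unzip2 R) (l, v) = unzip2 (rcons R (m, (l, v))).
  by rewrite /unzip2 map_rcons.
rewrite IH /unzip2 ?map_rcons.
- by rewrite -cats1 count_cat /= addn0 addnC.
- by rewrite weight_rcons.
- by rewrite rcons_uniq nv; case/andP: U.
rewrite pairwise_rcons [pairwise _ R]pR andbT; apply/allP => y /upR.
rewrite /upper /=; case: (m); case: (y.1) => /=; lia.
Qed.

Definition mark_all s : seq mrow := [seq (true, y) | y <- s].

Definition raise s : seq (nat * 'I_n) := [seq (y.1.+1, y.2) | y <- s].

Lemma factors_mark_all s :
  factors (mark_all s) <-> queue_sum (raise s) = mesym n K (size s) * queue_sum s.
Proof.
rewrite /factors /mark_all -map_comp count_map /unzip2 -map_comp map_id.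
by rewrite (eq_count (a2 := predT)) // count_predT.
Qed.

Lemma unzip2_mark_all s : unzip2 (mark_all s) = s.
Proof. by rewrite /unzip2 -map_comp map_id. Qed.

Lemma upper_mark_all s : pairwise upper (mark_all s).
Proof.
elim: s => //= y s ->; rewrite andbT; apply/allP => z /mapP[x _ ->].
by rewrite /upper /= !implybT.
Qed.

Lemma weight_cat p q : weight (p ++ q) = (weight p + weight q)%N.
Proof. by rewrite /weight map_cat sumn_cat. Qed.

Lemma weight_cons y s : weight (y :: s) = (y.1.+1 + weight s)%N.
Proof. by []. Qed.

(** Induction on the number of empty rows at the bottom. The exchange relation moves the nonempty
    row below the last of them, with the same coefficient before and after lengthening. Once no
    empty row is left at the bottom, filling a box lowers [weight]. *)
Lemma factors_mark_all_pos (p : seq 'I_n) l w q :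
  let s := [seq (0%N, a) | a <- p] ++ (l.+1, w) :: q in
  factors_below (weight s) -> uniq (unzip2 s) -> factors (mark_all s).
Proof.
elim/last_ind: p => [|p u IHp] in l w q *; move=> s IH U.
  have := @factors_rotate true l w (mark_all q).
  rewrite -[_ :: mark_all q]/(mark_all s) unzip2_mark_all.
  by apply=> //; exact: upper_mark_all.
apply/factors_mark_all.
move: IH U; rewrite /s map_rcons cat_rcons => IH U.
set p0 := [seq (0%N, a) | a <- p] in IH U *.
have := @queue_sum_swap 1 l.+2 u w (raise p0) (raise q) isT.
have raise0 : raise p0 ++ (1%N, u) :: (l.+2, w) :: raise q =
          raise (p0 ++ (0%N, u) :: (l.+1, w) :: q) by rewrite /raise map_cat.
have -> : uniq (unzip2 (raise p0 ++ [:: (1%N, u), (l.+2, w) & raise q])).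
  by rewrite raise0 /unzip2 -map_comp.
have btw : between 1 l.+2 (raise p0) (raise q) = between 0 l.+1 p0 q.
  by rewrite /between /raise !filter_map -!map_comp.
rewrite /swap_holds btw => /(_ isT).
have raiseE x y : raise p0 ++ [:: (l.+2, x), (1%N, y) & raise q] =
          raise (p0 ++ [:: (l.+1, x), (0%N, y) & q]) by rewrite /raise map_cat.
rewrite !raiseE raise0 (@queue_sum_swap 0 l.+1 u w p0 q isT U).
have fact x y : perm_eq [:: x; y] [:: u; w] ->
    queue_sum (raise (p0 ++ [:: (l.+1, x), (0%N, y) & q])) =
    mesym n K (size (p0 ++ [:: (0%N, u), (l.+1, w) & q]))
    * queue_sum (p0 ++ [:: (l.+1, x), (0%N, y) & q]).
  move=> pxy; have -> : size (p0 ++ [:: (0%N, u), (l.+1, w) & q])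
      = size (p0 ++ [:: (l.+1, x), (0%N, y) & q]) by rewrite !size_cat.
  apply/factors_mark_all; apply: IHp.
    (* The exchange preserves [weight], so [factors_below] still applies. *)
    rewrite -/p0 (_ : weight _ = weight (p0 ++ [:: (0%N, u), (l.+1, w) & q])) //.
    by rewrite !weight_cat !weight_cons /=; lia.
  move: U; rewrite !unzip2_cat /= => U.
  rewrite (perm_uniq (_ : perm_eq _ (unzip2 p0 ++ [:: u, w & unzip2 q]))) //.
  by rewrite perm_cat2l -[X in perm_eq X]cat1s -(cat1s y) catA -(cat1s u)
     -(cat1s w) (catA [:: u]) perm_cat2r.
have pwu : perm_eq [:: w; u] [:: u; w].
  by rewrite -(cat1s w) -(cat1s u) perm_catC.
by move=> ->; rewrite !fact // mulrDr scalerAr.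
Qed.

Lemma zeros_prefix s : ~~ all (fun y => y.1 == 0%N) s ->
  exists (z : seq 'I_n) l w q, s = [seq (0%N, a) | a <- z] ++ (l.+1, w) :: q.
Proof.
elim: s => //= [[[|l] a] s] IH /=; last by exists [::], l, a, s.
by move=> /IH[z [l [w [q ->]]]]; exists (a :: z), l, w, q.
Qed.

Lemma factorsP R : uniq (unzip2 (unzip2 R)) -> pairwise upper R -> factors R.
Proof.
have [k] := ubnP (weight (unzip2 R)); elim: k => // k IH in R *.
rewrite ltnS => wk.
have below : factors_below (weight (unzip2 R)).
  by move=> R' lt_R'; apply: IH; exact: leq_trans wk.
case: R wk below => [|[m [[|l] a]] R] wk below U.
- rewrite /factors /= mulr1 /mesym (big_pred1 set0) ?big_set0 //= => V.
  by rewrite cards_eq0.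
- case: m wk below U => wk below U; last first.
    move=> /andP[_ pR]; rewrite /factors /= !queue_sum_drop; apply: IH => //.
    by case/andP: U.
  move=> /andP[/allP upR pR].
  (* An empty row at the bottom is the smallest of all; as it is marked, every row is. *)
  have RE : (true, (0%N, a)) :: R = mark_all ((0%N, a) :: unzip2 R).
    rewrite /mark_all /= /unzip2 -map_comp; congr (_ :: _).
    rewrite -[LHS]map_id; apply/eq_in_map => [[m' y]] /upR.
    by rewrite /upper /= => /andP[->].
  move: below U; rewrite RE unzip2_mark_all.
  move: ((0%N, a) :: unzip2 R) => s below U.
  have [z|nz] := boolP (all (fun y => y.1 == 0%N) s).
    have zE : s = [seq (0%N, a) | a <- unzip2 s].
      rewrite /unzip2 -map_comp -[LHS]map_id; apply/eq_in_map => [[j b]].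
      by move/(allP z) => /eqP /= ->.
    apply/factors_mark_all.
    rewrite [in RHS]zE queue_sum_zeros mulr1 -(size_map snd).
    by rewrite -queue_sum_ones // zE /raise -!map_comp.
  have [p [l [w [q sE]]]] := zeros_prefix nz.
  move: below U; rewrite sE => below U.
  exact: factors_mark_all_pos.
exact: factors_rotate.
Qed.

End Queue.

(** * From fillings to queues *)

Section Transfer.
Variables (n : nat) (K : fieldType) (t : K) (lam : weak_comp n).
Implicit Types (F : filling lam) (u z : box lam) (i j : 'I_n) (r : seq 'I_n).

(** Beyond the end of the row [inord] falls back to column 0, hence the guard in [col_bx]. *)
Definition bx i (c : nat) : box lam :=
  existT (fun i => 'I_(lam i).+1) i (inord c).

Lemma row_bx i c : row (bx i c) = i. Proof. by []. Qed.

Lemma col_bx i c : (c <= lam i)%N -> col (bx i c) = c.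
Proof. by move=> ci; rewrite /col /= inordK. Qed.

Lemma bx_rowcol u : bx (row u) (col u) = u.
Proof. by case: u => i k; rewrite /bx /row /col /= inord_val. Qed.

Lemma col_le u : (col u <= lam (row u))%N.
Proof. by case: u => i k; rewrite /col /row /= -ltnS. Qed.

Lemma box_eq u z : row u = row z -> col u = col z -> u = z.
Proof. by move=> er ec; rewrite -(bx_rowcol u) er ec bx_rowcol. Qed.

Definition top (k : nat) : seq 'I_n := [seq j : 'I_n <- enum 'I_n | (j < k)%N].
Definition bot (k : nat) : seq 'I_n := [seq j : 'I_n <- enum 'I_n | (k <= j)%N].

Lemma enum_split i : exists p1 p2, [/\ enum 'I_n = p1 ++ i :: p2,
  {in p1, forall j, (j < i)%N} & {in p2, forall j, (i < j)%N}].
Proof.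
exists (take i (enum 'I_n)), (drop i.+1 (enum 'I_n)); split.
- by rewrite -[LHS](cat_take_drop i) (drop_nth i) ?size_enum_ord // nth_ord_enum.
- move=> j /(map_f val); rewrite map_take val_enum_ord take_iota mem_iota.
  by rewrite add0n => /andP[_]; have := ltn_ord i; rewrite /minn; case: ifP.
move=> j /(map_f val); rewrite map_drop val_enum_ord drop_iota mem_iota.
by rewrite add0n => /andP[].
Qed.

Lemma topS i : top i.+1 = rcons (top i) i.
Proof.
rewrite /top; have [p1 [p2 [-> lt1 lt2]]] := enum_split i.
rewrite !filter_cat /= ltnn ltnSn.
rewrite -[in LHS](eq_in_filter (a1 := fun j => j < i)%N); last first.
  by move=> j /lt1; lia.
rewrite -cats1 -catA; congr (_ ++ _).
rewrite (eq_in_filter (a2 := pred0)) => [|j /lt2 /=]; last by lia.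
rewrite [in RHS](eq_in_filter (a2 := pred0)) => [|j /lt2 /=]; last by lia.
by rewrite !filter_pred0.
Qed.

Lemma botS i : bot i = i :: bot i.+1.
Proof.
rewrite /bot; have [p1 [p2 [-> lt1 lt2]]] := enum_split i.
rewrite !filter_cat /= ltnn leqnn.
rewrite (eq_in_filter (a2 := pred0)) => [|j /lt1 /=]; last by lia.
rewrite [in RHS](eq_in_filter (a2 := pred0)) => [|j /lt1 /=]; last by lia.
rewrite !filter_pred0; congr (_ :: _); apply: eq_in_filter => j /lt2; lia.
Qed.

Definition part F c r : seq (nat * 'I_n) :=
  [seq ((lam i - c)%N, F (bx i c)) | i <- rev r & (c <= lam i)%N].

(** The state in which, in column [c.+1], exactly the rows from [k] on are filled: these have moved
    to the back, while the others still show their entry in column [c]. *)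
Definition queue F c k := part F c (top k) ++ part F c.+1 (bot k).

Definition others F i c := part F c (top i) ++ part F c.+1 (bot i.+1).

Lemma part_rcons F c r i : part F c (rcons r i) =
  if (c <= lam i)%N then ((lam i - c)%N, F (bx i c)) :: part F c r
  else part F c r.
Proof. by rewrite /part rev_rcons /=; case: ifP. Qed.

Lemma part_cons F c r i : part F c (i :: r) =
  if (c <= lam i)%N then rcons (part F c r) ((lam i - c)%N, F (bx i c))
  else part F c r.
Proof.
by rewrite /part rev_cons filter_rcons; case: ifP; rewrite // map_rcons.
Qed.

Lemma queue_before F c i : queue F c i.+1 =
  if (c <= lam i)%N then ((lam i - c)%N, F (bx i c)) :: others F i c
  else others F i c.
Proof. by rewrite /queue topS part_rcons; case: ifP. Qed.

Lemma queue_after F c i : queue F c i =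
  if (c < lam i)%N then rcons (others F i c) ((lam i - c.+1)%N, F (bx i c.+1))
  else others F i c.
Proof. by rewrite /queue botS part_cons; case: ifP; rewrite // rcons_cat. Qed.

Lemma bot_n : bot n = [::].
Proof.
rewrite /bot (eq_filter (a2 := pred0)) ?filter_pred0 // => j.
by rewrite leqNgt ltn_ord.
Qed.

Lemma queue0 F c : queue F c 0 = queue F c.+1 n.
Proof.
rewrite /queue; have -> : top 0 = [::] by rewrite /top filter_pred0.
rewrite bot_n /= cats0; congr part; rewrite /bot /top; apply: eq_filter => j.
by rewrite ltn_ord.
Qed.

(** The indicator vanishes on a conflict with a box filled earlier, so sums may run over all
    fillings. *)
Definition box_weight F u : {mpoly K[n]} :=
  let s := others F (row u) (col u).-1 in
  (F u \notin unzip2 s)%:R *: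
  (phi t (F (left_box u)) (F u) (lower (lam (row u) - (col u).-1) s)
     *: 'X_(F u)).

(* The boxes filled when, in column [c.+1], exactly the rows from [k] on are. *)
Definition filled c k u :=
  (col u <= c)%N || ((col u == c.+1) && (k <= row u)%N).

Definition agree c k F0 F := [forall u, filled c k u ==> (F u == F0 u)].

Definition completions c k F0 : {mpoly K[n]} :=
  \sum_(F | agree c k F0 F) \prod_(u | ~~ filled c k u) box_weight F u.

Lemma part_ext F F' c r : {in r, forall i, (c <= lam i)%N ->
  F (bx i c) = F' (bx i c)} -> part F c r = part F' c r.
Proof.
move=> eqF; apply/eq_in_map => i; rewrite mem_filter mem_rev.
by move=> /andP[ci ir]; rewrite eqF.
Qed.

Lemma others_ext F F' i c : (forall u, filled c i.+1 u -> F u = F' u) ->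
  others F i c = others F' i c.
Proof.
move=> eqF; congr (_ ++ _); apply: part_ext => j.
all: rewrite mem_filter => /andP[ji _] cj.
  by apply: eqF; rewrite /filled col_bx ?leqnn.
by apply: eqF; rewrite /filled col_bx ?eqxx ?ji ?orbT.
Qed.

Lemma eq_completions c c' k k' F0 : filled c k =1 filled c' k' ->
  completions c k F0 = completions c' k' F0.
Proof.
move=> e; apply: eq_big => F; first by apply: eq_forallb => u; rewrite e.
by move=> _; apply: eq_bigl => u; rewrite e.
Qed.

Lemma filledS c i u :
  filled c i u = filled c i.+1 u || (u == bx i c.+1) && (c < lam i)%N.
Proof.
have -> : (u == bx i c.+1) && (c < lam i)%N = (row u == i) && (col u == c.+1).
  apply/andP/andP => [[/eqP-> lt_c]|[/eqP er /eqP ec]].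
    by rewrite col_bx // row_bx !eqxx.
  by rewrite -er -ec bx_rowcol eqxx col_le.
by rewrite /filled -val_eqE /=; lia.
Qed.

(** The next box to fill is in row [i] and column [c.+1]. Its weight depends only on its entry and
    on earlier boxes, so splitting the fillings by that entry gives one step of the queue
    recursion. *)
Lemma completions_step c i F0 :
  (forall F, completions c i F = queue_sum t (queue F c i)) ->
  completions c i.+1 F0 = queue_sum t (queue F0 c i.+1).
Proof.
move=> IH; rewrite queue_before.
case: (ltnP c (lam i)) => [ltc|lec]; last first.
  (* Without such a box, row [i] is either just exhausted and dropped from the front, or has left
     the queue before. *)
  rewrite (@eq_completions _ c _ i) => [|u]; last first.
    by rewrite filledS ltnNge lec andbF orbF.
  rewrite IH queue_after ltnNge lec /=; case: leqP => // ci.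
  by rewrite (_ : lam i - c = 0)%N ?queue_sum_drop //; lia.
rewrite ltnW // -(subnSK ltc) queue_sum_rotate.
pose u := bx i c.+1.
have rowu : row u = i by [].
have colu : col u = c.+1 by rewrite col_bx.
have nfu : ~~ filled c i.+1 u by rewrite /filled rowu colu !ltnn andbF.
pose up v : filling lam := [ffun z => if z == u then v else F0 z].
have up_u v : up v u = v by rewrite ffunE eqxx.
have up_filled v z : filled c i.+1 z -> up v z = F0 z.
  by rewrite ffunE; case: eqP => // ->; rewrite (negPf nfu).
have fl : filled c i.+1 (bx i c) by rewrite /filled col_bx ?leqnn // ltnW.
have leftu : left_box u = bx i c by rewrite /left_box colu.
rewrite /completions (partition_big (fun F => F u) xpredT) //= big_mkcond /=.
rewrite [RHS]big_mkcond /=; apply: eq_bigr => v _.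
transitivity (box_weight (up v) u * completions c i (up v)).
  rewrite /completions big_distrr /=; apply: eq_big => [F|F].
    apply/andP/forallP => [[/forallP ag /eqP Fu] z|ag].
      rewrite filledS; apply/implyP => /orP[fz|/andP[/eqP-> _]].
        by rewrite up_filled //; apply: (implyP (ag z)).
      by rewrite up_u Fu.
    split; last by have := ag u; rewrite filledS eqxx ltc orbT up_u.
    apply/forallP => z; apply/implyP => fz; rewrite -(up_filled v) //.
    by apply: (implyP (ag z)); rewrite filledS fz.
  move=> /andP[/forallP ag /eqP Fu]; rewrite (bigD1 u) //=; congr (_ * _).
    have ag' z : filled c i.+1 z -> F z = up v z.
      by move=> fz; rewrite up_filled //; apply/eqP/(implyP (ag z)).
    rewrite /box_weight rowu colu /= (others_ext (F' := up v)) //.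
    by rewrite Fu up_u leftu ag'.
  by apply: eq_bigl => z; rewrite filledS ltc andbT negb_or.
rewrite IH queue_after ltc /box_weight; cbv zeta.
rewrite rowu colu -[c.+1.-1]/c up_u leftu.
rewrite (others_ext (up_filled v)) up_filled // (subnSK ltc).
case: ifP => nv; last by rewrite scale0r mul0r.
by rewrite scale1r -scalerAl.
Qed.

(** The induction runs against the order of filling. A completed column [c.+1] ([k = 0]) is the same
    state as an untouched column [c.+2] ([k = n] for [c.+1]). *)
Lemma completionsE c k F0 : (k <= n)%N ->
  completions c k F0 = queue_sum t (queue F0 c k).
Proof.
have [d] := ubnP (\max_i lam i - c); elim: d => // d IHd in c k F0 *.
rewrite ltnS => led; elim: k F0 => [|k IHk] F0 kn; last first.
  by apply: (@completions_step c (Ordinal kn)) => F; apply: IHk; exact: ltnW.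
have filled0 : filled c 0 =1 filled c.+1 n.
  move=> u; rewrite /filled leq0n andbT.
  by have := ltn_ord (row u); lia.
rewrite (eq_completions _ filled0) queue0.
have [ltc|lec] := ltnP c (\max_i lam i).
  by apply: IHd => //; lia.
have all_filled u : filled c.+1 n u.
  rewrite /filled (leq_trans (col_le u)) //.
  by rewrite (leq_trans (leq_bigmax (row u))) // ltnW.
rewrite /completions (big_pred1 F0) => [|F]; last first.
  apply/forallP/eqP => [ag|-> u]; last by rewrite eqxx implybT.
  by apply/ffunP => u; apply/eqP; have := ag u; rewrite all_filled.
rewrite big_pred0 => [|u]; last by rewrite all_filled.
rewrite /queue bot_n cats0 /part (eq_filter (a2 := pred0)) ?filter_pred0 // => i.
by rewrite leqNgt ltnS (leq_trans (leq_bigmax i)).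
Qed.

Lemma mem_part x F c r : reflect
  (exists j, [/\ j \in r, (c <= lam j)%N & F (bx j c) = x])
  (x \in unzip2 (part F c r)).
Proof.
rewrite /unzip2 -map_comp; apply: (iffP mapP) => [[j]|[j [jr cj e]]].
  by rewrite mem_filter mem_rev => /andP[cj jr] ->; exists j.
by exists j; rewrite // mem_filter mem_rev cj.
Qed.

Lemma mem_top i k : (i \in top k) = (i < k)%N.
Proof. by rewrite mem_filter mem_enum andbT. Qed.

Lemma mem_bot i k : (i \in bot k) = (k <= i)%N.
Proof. by rewrite mem_filter mem_enum andbT. Qed.

Definition free F u := F u \notin unzip2 (others F (row u) (col u).-1).

Lemma freeP F u : nonbasement u -> reflect
  (forall z, F z = F u ->
     ~ ((col z).+1 = col u /\ (row z < row u)%N) /\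
     ~ (col z = col u /\ (row u < row z)%N))
  (free F u).
Proof.
rewrite /nonbasement /free unzip2_cat mem_cat => cu.
apply: (iffP idP) => [/norP[n1 n2] z Fz|H].
  split=> [[ez lt]|[ez lt]].
    case/mem_part: n1; exists (row z).
    by rewrite mem_top lt -ez /= col_le bx_rowcol.
  case/mem_part: n2; exists (row z).
  by rewrite mem_bot lt prednK // -ez col_le bx_rowcol.
apply/norP; split; apply/mem_part => -[j [+ + /H]].
  by rewrite mem_top => lt cj [+ _]; apply; rewrite row_bx col_bx // prednK.
by rewrite mem_bot prednK // => lt cj [_]; apply; rewrite row_bx col_bx.
Qed.

Lemma basement_bx i : basement_box lam i = bx i 0.
Proof. by apply: box_eq; rewrite // col_bx. Qed.

(** An attacking pair not inside the basement is detected by [free] at the box filled later; inside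
    the basement, injectivity of [sigma] excludes attacks. *)
Lemma nonattackingP F (sigma : 'S_n) :
  (F \in NAF lam sigma) =
  [forall i, F (basement_box lam i) == sigma i] &&
  [forall u, nonbasement u ==> free F u].
Proof.
rewrite inE; apply: andb_id2l => /forallP base.
apply/forallP/forallP => [na u|fr u].
  apply/implyP => cu; apply/(freeP _ cu) => z Fz.
  split=> [[ez lt]|[ez lt]].
    have /forallP/(_ u) := na z; rewrite /attacking Fz eqxx -ez eqxx lt !orbT.
    by rewrite !andbT negbK => /eqP e; move: lt; rewrite e ltnn.
  have /forallP/(_ z) := na u; rewrite /attacking Fz eqxx -ez eqxx.
  by rewrite !andbT negbK => /eqP e; move: lt; rewrite e ltnn.
apply/forallP => v; apply/negP => /and3P[ne /eqP Fuv].
case/orP=> [/eqP ec|/andP[/eqP ec lt]]; last first.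
  have cv : nonbasement v by rewrite /nonbasement ec.
  by have /implyP/(_ cv)/(freeP _ cv)/(_ u Fuv)[[]] := fr v.
have [c0|cu] := posnP (col u).
  have Fbase z : col z = 0%N -> F z = sigma (row z).
    by move=> cz; rewrite -(eqP (base (row z))) basement_bx -cz bx_rowcol.
  move: Fuv; rewrite !Fbase -?ec // => /perm_inj er.
  by rewrite (box_eq er ec) eqxx in ne.
case: (ltngtP (row u) (row v)) => [lt|gt|/val_inj er].
- by have /implyP/(_ cu)/(freeP _ cu)/(_ v (esym Fuv))[_ []] := fr u.
- have cv : nonbasement v by rewrite /nonbasement -ec.
  by have /implyP/(_ cv)/(freeP _ cv)/(_ u Fuv)[_ []] := fr v.
by rewrite (box_eq er ec) eqxx in ne.
Qed.

(** * Triples, arms and the weight of a filling *)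

Lemma card_count (A : pred 'I_n) : #|A| = count A (enum 'I_n).
Proof.
rewrite cardE -size_filter /enum_mem -filter_predI; congr size.
by apply: eq_filter => j; rewrite /= andbT.
Qed.

Lemma count_part (P : pred 'I_n) F l c r :
  count P (lower l (part F c r)) =
  count (fun j => [&& c <= lam j, lam j - c < l & P (F (bx j c))])%N r.
Proof.
rewrite /lower /part count_map count_filter count_map count_filter count_rev.
by apply: eq_count => j /=; rewrite andbC [P _ && _]andbC.
Qed.

Definition triple u z := triple_A u z || triple_B u z.

Lemma tripleP u z : nonbasement u -> reflect
  ([/\ col z = col u, row u < row z & lam (row z) <= lam (row u)]%N \/
   [/\ (col z).+1 = col u, row z < row u & lam (row z) < lam (row u)]%N)
  (triple u z).
Proof.
move=> cu; rewrite /triple /triple_A /triple_B cu /=.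
apply: (iffP orP); first by case=> /and3P[/eqP-> -> ->]; [left | right].
by case=> -[-> -> ->]; rewrite eqxx; [left | right].
Qed.

Lemma count_others (P : pred 'I_n) F u : nonbasement u ->
  count P (lower (lam (row u) - (col u).-1) (others F (row u) (col u).-1))
  = #|[set z | triple u z && P (F z)]|.
Proof.
rewrite /nonbasement => cu; set i := row u; set c := (col u).-1.
have cE : col u = c.+1 by rewrite /c prednK.
have ci : (c < lam i)%N by rewrite -cE col_le.
(* A triple with [u] as its box [b] is determined by the row of its third box, which lies in the
   column left of [u] for rows above and in the column of [u] for rows below. *)
pose zb j := bx j (if (j < i)%N then c else c.+1).
pose J1 := [pred j : 'I_n | (j < i)%N
  & [&& c <= lam j, lam j - c < lam i - c & P (F (bx j c))]%N].
pose J2 := [pred j : 'I_n | (i < j)%N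
  & [&& c.+1 <= lam j, lam j - c.+1 < lam i - c & P (F (bx j c.+1))]%N].
have zb_inj : injective zb by move=> j k /(congr1 (fun z => row z)).
have -> : [set z | triple u z && P (F z)] = zb @: [pred j | J1 j || J2 j].
  apply/setP => z; rewrite inE.
  apply/andP/imsetP => [[/(tripleP _ cu) tz Pz]|[j Jj ->]].
    exists (row z).
      rewrite inE /= /i; have := col_le z; have := bx_rowcol z.
      case: tz => -[ez lt le]; first by rewrite ez cE => ->; rewrite lt Pz; lia.
      by have -> : col z = c by [lia]; move=> ->; rewrite lt Pz orbC; lia.
    apply: box_eq; rewrite // /zb; have cz := col_le z.
    case: tz => -[ez lt le].
      rewrite ltnNge ltnW //= ez cE col_bx // -cE -ez //.
    by rewrite lt col_bx; lia.
  move: Jj; rewrite /zb inE /= => /orP[] /and4P[lt cj lj Pj].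
    rewrite lt; split=> //; apply/tripleP => //; right.
    by rewrite row_bx col_bx // cE -/i; split=> //; lia.
  rewrite ltnNge ltnW //=; split=> //; apply/tripleP => //; left.
  by rewrite row_bx col_bx // cE -/i; split=> //; lia.
rewrite card_imset // card_count.
rewrite /others lower_cat count_cat !count_part /top /bot.
rewrite (count_filter _ (fun j : 'I_n => j < i)%N).
rewrite (count_filter _ (fun j : 'I_n => i < j)%N).
transitivity (count J1 (enum 'I_n) + count J2 (enum 'I_n))%N.
  by congr (_ + _)%N; apply: eq_count => j /=; rewrite andbC.
rewrite -count_predUI.
rewrite [X in (_ + X)%N](eq_count (a2 := pred0)) => [|j /=]; last first.
  by case: ltngtP; rewrite ?andbF.
by rewrite count_pred0 addn0; apply: eq_count => j.
Qed.

Lemma armE F u : nonbasement u -> arm u =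
  size (lower (lam (row u) - (col u).-1) (others F (row u) (col u).-1)).
Proof.
move=> cu; rewrite -(count_predT (lower _ _)).
rewrite /nonbasement in cu; set i := row u; set c := (col u).-1.
have cE : col u = c.+1 by rewrite /c prednK.
rewrite /others lower_cat count_cat !count_part /top /bot.
rewrite (count_filter _ (fun j : 'I_n => j < i)%N).
rewrite (count_filter _ (fun j : 'I_n => i < j)%N).
rewrite /arm !cardsE !card_count addnC -/i -/c cE.
by congr (_ + _)%N; apply: eq_count => j /=; lia.
Qed.

(** A tie can occur only between [u] and its left neighbour, and then the second coordinates make
    the triple an inversion triple. *)
Lemma inversion_tripleE F u z : F z != F u -> F z != F (left_box u) ->
  ~~ inversion_triple F u z =
  (F u != F (left_box u)) && off_arc (F (left_box u)) (F u) (F z).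
Proof.
rewrite /inversion_triple /lex_lt /off_arc -!val_eqE /=.
by case: (ltngtP (F z) (F u)) => //;
   case: (ltngtP (F z) (F (left_box u))) => //;
   case: (ltngtP (F u) (F (left_box u))) => //=; lia.
Qed.

Lemma triple_neq F u z : (forall x y, ~~ attacking F x y) -> nonbasement u ->
  triple u z -> F z != F u /\ F z != F (left_box u).
Proof.
move=> na cu tz.
have neq x y :
    (col x == col y) || ((col y == (col x).+1) && (row x < row y)%N) ->
    x != y -> F x != F y.
  by move=> c ne; have := na x y; rewrite /attacking c ne andbT.
have colL : (col (left_box u)).+1 = col u.
  rewrite -[left_box u]/(bx (row u) (col u).-1) col_bx ?prednK //.
  by have := col_le u; move: cu; rewrite /nonbasement; lia.
have rowL : row (left_box u) = row u by [].
have neR x y : row x <> row y -> x != y.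
  by move=> nr; apply/eqP => e; rewrite e in nr.
case/tripleP: tz => // -[ez lt le].
  split.
    by apply: neq; [rewrite ez eqxx | apply: neR => e; rewrite e ltnn in lt].
  rewrite eq_sym; apply: neq; first by rewrite ez colL rowL eqxx lt orbT.
  by apply: neR => e; rewrite -e rowL ltnn in lt.
split; apply: neq.
- by rewrite -ez eqxx lt orbT.
- by apply: neR => e; rewrite e ltnn in lt.
- by rewrite -eqSS ez colL eqxx.
by apply: neR => e; rewrite e rowL ltnn in lt.
Qed.

Definition box_phi F u : K :=
  phi t (F (left_box u)) (F u)
    (lower (lam (row u) - (col u).-1) (others F (row u) (col u).-1)).

(** Each coinversion triple is attributed to its box [b]. A box repeating the entry to its left has
    none, matching the value 1 of [phi]. *)
Lemma filling_weightE F : (forall x y, ~~ attacking F x y) ->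
  filling_weight 1 t F = \prod_(u | nonbasement u) box_phi F u.
Proof.
move=> na; rewrite /filling_weight expr1n mul1r.
have -> : coinv F = (\sum_(u | nonbasement u)
    #|[set z | triple u z && ~~ inversion_triple F u z]|)%N.
  rewrite /coinv -sum1_card.
  rewrite (eq_bigl (fun p => nonbasement p.1
     && (triple p.1 p.2 && ~~ inversion_triple F p.1 p.2))); last first.
    move=> p; rewrite inE -/(triple _ _).
    case: (boolP (nonbasement p.1)) => //= cu.
    by rewrite /triple /triple_A /triple_B (negPf cu).
  rewrite -(pair_big_dep (@nonbasement n lam)
    (fun u z => triple u z && ~~ inversion_triple F u z) (fun _ _ => 1%N)) /=.
  apply: eq_bigr => u _; rewrite -sum1_card.
  by apply: eq_bigl => z; rewrite inE.
rewrite expr_sum big_mkcondr -big_split /=; apply: eq_bigr => u cu.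
have -> : [set z | triple u z && ~~ inversion_triple F u z] =
  [set z | triple u z && ((F u != F (left_box u))
     && off_arc (F (left_box u)) (F u) (F z))].
  apply/setP => z; rewrite !inE; apply: andb_id2l => tz.
  by have [n1 n2] := triple_neq na cu tz; rewrite inversion_tripleE.
rewrite /box_phi /phi [F u == _]eq_sym; case: eqP => /= _.
  rewrite mulr1 (_ : [set z | _] = set0) ?cards0 //.
  by apply/setP => z; rewrite !inE andbF.
by rewrite -count_others // -armE // expr1n mul1r mulrC add1n.
Qed.

Lemma macdonaldE (sigma : 'S_n) :
  macdonald sigma lam 1 t
  = queue_sum t [seq (lam i, sigma i) | i <- rev (enum 'I_n)].
Proof.
pose F0 : filling lam := [ffun u => sigma (row u)].
have qE : queue F0 0 n = [seq (lam i, sigma i) | i <- rev (enum 'I_n)].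
  rewrite /queue bot_n cats0 /part (_ : top n = enum 'I_n); last first.
    rewrite /top (eq_filter (a2 := predT)) ?filter_predT // => j.
    by rewrite ltn_ord.
  rewrite (eq_filter (a2 := predT)) ?filter_predT //.
  by apply: eq_map => i; rewrite subn0 ffunE.
rewrite -qE -completionsE // /macdonald /completions.
have filledE u : filled 0 n u = (col u == 0%N).
  by rewrite /filled [(n <= _)%N]leqNgt ltn_ord andbF orbF leqn0.
have agE F : agree 0 n F0 F = [forall i, F (basement_box lam i) == sigma i].
  apply/forallP/forallP => H.
    move=> i; rewrite basement_bx; have := H (bx i 0).
    by rewrite filledE col_bx //= ffunE.
  move=> u; rewrite filledE; apply/implyP => /eqP cu.
  by rewrite -(bx_rowcol u) cu -basement_bx (eqP (H _)) ffunE.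
rewrite (eq_bigl (fun F => agree 0 n F0 F
  && [forall u, nonbasement u ==> free F u])); last first.
  by move=> F; rewrite nonattackingP agE.
rewrite big_mkcondr /=; apply: eq_bigr => F ag.
rewrite [RHS](eq_bigl (fun u => nonbasement u)); last first.
  by move=> u; rewrite filledE -lt0n.
case: ifP => fr; last first.
  move/negbT: fr; rewrite negb_forall => /existsP[u].
  rewrite negb_imply => /andP[cu nf]; rewrite (bigD1 u) //=.
  by rewrite /box_weight -/(free F u) (negPf nf) scale0r mul0r.
have na x y : ~~ attacking F x y.
  have : F \in NAF lam sigma by rewrite nonattackingP -agE ag.
  by rewrite inE => /andP[_ /forallP/(_ x)/forallP].
rewrite filling_weightE // /filling_monomial -scaler_prod.
apply: eq_bigr => u cu; have /implyP/(_ cu) := forallP fr u.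
by rewrite /box_weight -/(free F u) => ->; rewrite scale1r.
Qed.

End Transfer.

(** * Factorization through the weak standardization *)

Section Factorization.
Variables (n : nat) (K : fieldType) (t : K).
Hypothesis t_neq0 : t != 0.
Hypothesis denom_neq0 : forall k, 1 - t ^+ k.+1 != 0.
Implicit Types (lam mu : weak_comp n) (sigma : 'S_n).

(** The rows of length at least [v] form an upper set however ties are broken, so [factorsP]
    applies. *)
Lemma macdonald_raise sigma lam mu v :
  (forall i, lam i = ((v <= mu i) + mu i)%N) ->
  macdonald sigma lam 1 t =
  mesym n K #|[pred i | (v <= mu i)%N]| * macdonald sigma mu 1 t.
Proof.
move=> lamE; rewrite !macdonaldE.
pose R : seq (mrow n) :=
  [seq ((v <= mu i)%N, (mu i, sigma i)) | i <- rev (enum 'I_n)].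
have -> : [seq (lam i, sigma i) | i <- rev (enum 'I_n)] = map (@add_mark n) R.
  by rewrite /R -map_comp; apply: eq_map => i; rewrite /add_mark /= lamE.
have -> : [seq (mu i, sigma i) | i <- rev (enum 'I_n)] = unzip2 R.
  by rewrite /R /unzip2 -map_comp.
have -> : #|[pred i | (v <= mu i)%N]| = count fst R.
  by rewrite /R count_map count_rev card_count.
apply: factorsP => //.
  rewrite /R /unzip2 -!map_comp map_inj_uniq ?rev_uniq ?enum_uniq //.
  by move=> i j /= /perm_inj.
rewrite pairwise_map; elim: (rev _) => //= i r ->; rewrite andbT.
apply/allP => j _; rewrite /upper /=; lia.
Qed.

Lemma same_order_weak_std lam mu :
  same_order lam mu -> weak_std lam = weak_std mu.
Proof.
have le lam' mu' :
    same_order lam' mu' -> forall i, (weak_std lam' i <= weak_std mu' i)%N.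
  move=> so; apply: weak_std_min => i j; rewrite so; exact: weak_std_same_order.
move=> so; apply/ffunP => i; apply/eqP; rewrite eqn_leq !le //.
by move=> j k; rewrite so.
Qed.

Lemma weak_std_id lam : (forall i v, (v < lam i)%N -> exists j, lam j = v) ->
  weak_std lam = lam.
Proof.
move=> onto; apply/ffunP => i; rewrite ffunE -[RHS](size_iota 0).
apply/perm_size/uniq_perm; rewrite ?undup_uniq ?iota_uniq // => v.
rewrite mem_undup mem_iota add0n /=; apply/mapP/idP => [[j]|lt_v].
  by rewrite mem_filter => /andP[lt_j _] ->.
have [j jv] := onto _ _ lt_v; exists j => //.
by rewrite mem_filter mem_enum jv lt_v.
Qed.

(** Induction on the number of boxes. If a value [v] below some part is not attained, all parts
    above [v] can be lowered by one without changing the order; if there is no such value, [lam] is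
    its own weak standardization. *)
Lemma macdonald_weak_std lam : exists nu : seq nat, 0%N \notin nu /\
  forall sigma, macdonald sigma lam 1 t =
    elementary n K nu * macdonald sigma (weak_std lam) 1 t.
Proof.
have [k] := ubnP (\sum_i lam i); elim: k => // k IH in lam *.
rewrite ltnS => lek.
have [|] := boolP [exists i, exists v : 'I_(lam i), [forall j, lam j != v]].
  case/existsP=> i0 /existsP[[v lt_v] /forallP /= gap].
  pose mu : weak_comp n :=
    [ffun i => if (v < lam i)%N then (lam i).-1 else lam i].
  have lamE i : lam i = ((v <= mu i) + mu i)%N.
    by rewrite ffunE; have := gap i; case: ifP; lia.
  have so : same_order mu lam.
    by move=> i j; rewrite !ffunE; have := gap i; have := gap j;
       do 2!case: ifP; lia.
  have [|nu [nu0 nuE]] := IH mu.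
    apply: leq_trans lek.
    rewrite (bigD1 i0) // [ltnRHS](bigD1 i0) //= -addSn leq_add //.
      by rewrite ffunE lt_v; lia.
    by apply: leq_sum => i _; rewrite ffunE; case: ifP; lia.
  exists (#|[pred i | (v <= mu i)%N]| :: nu); split.
    rewrite inE negb_or nu0 andbT eq_sym -lt0n; apply/card_gt0P; exists i0.
    by rewrite inE ffunE lt_v; lia.
  move=> sigma; rewrite (macdonald_raise sigma lamE) nuE.
  by rewrite /elementary big_cons mulrA (same_order_weak_std so).
rewrite negb_exists => /forallP full.
exists [::]; split=> // sigma; rewrite /elementary big_nil mul1r weak_std_id //.
move=> i v lt_v; have := full i; rewrite negb_exists.
move=> /forallP/(_ (Ordinal lt_v)).
by rewrite negb_forall => /existsP[j]; rewrite negbK => /eqP; exists j.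
Qed.

(** [P] stands for positivity: at x = (1, ..., 1) the recursion only adds and multiplies elements of
    [P]. *)
Lemma macdonald_neq0 (P : K -> Prop) sigma lam :
  P 1 -> (forall x y, P x -> P y -> P (x + y)) ->
  (forall x y, P x -> P y -> P (x * y)) ->
  P t -> (forall k, P ((1 - t) / (1 - t ^+ k.+1))) -> ~ P 0 ->
  macdonald sigma lam 1 t != 0.
Proof.
move=> P1 PD PM Pt Pd P0; rewrite macdonaldE.
set s := map _ _; have us : uniq (unzip2 s).
  rewrite /s /unzip2 -map_comp map_inj_uniq ?rev_uniq ?enum_uniq //.
  by move=> i j /= /perm_inj.
move: s us => s us; apply: contra_notN P0 => /eqP s0.
suff: P (queue_sum t s).@[fun => 1] by rewrite s0 meval0.
clear s0; have [k] := ubnP (weight s); elim: k => // k IH in s us *.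
rewrite ltnS; case: s us => [|[[|l] a] s] us ws; first by rewrite meval1.
  by rewrite queue_sum_drop; apply: IH => //; case/andP: us.
have /= /andP[nas us'] := us.
have Pphi v : P (phi t a v (lower l.+1 s)).
  rewrite /phi; case: eqP => // _; apply: (PM) => //.
  by elim: (count _ _) => [|c Pc]; rewrite ?expr0 // exprS; apply: (PM).
have Pterm v : v \notin unzip2 s ->
    P (phi t a v (lower l.+1 s)
         *: ('X_v * queue_sum t (rcons s (l, v)))).@[fun => 1].
  move=> nv; rewrite mevalZ mevalM mevalXU mul1r; apply: (PM) => //.
  apply: IH; first by rewrite /unzip2 map_rcons rcons_uniq nv.
  by rewrite weight_rcons; exact: leq_trans ws.
(* The entry [v = a] is always admissible because the entries in the queue are distinct. This keeps
   the sum from being empty, which matters as [P] excludes 0. *)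
rewrite queue_sum_rotate (bigD1 a) //= mevalD raddf_sum /=.
elim/big_rec: _ => [|v x /andP[nv _] Px]; first by rewrite addr0; exact: Pterm.
by rewrite addrCA; apply: (PD) => //; exact: Pterm.
Qed.

End Factorization.

(** * Positivity of rational functions at 1/2, and the conclusion *)

Definition positive_at_half (f : Qt) : Prop :=
  exists p d : {poly rat},
    [/\ 0 < p.[1 / 2], 0 < d.[1 / 2] & f = tofrac p / tofrac d].

Lemma positive_frac (p d : {poly rat}) : 0 < p.[1 / 2] -> 0 < d.[1 / 2] ->
  positive_at_half (tofrac p / tofrac d).
Proof. by exists p, d. Qed.

Lemma positive_poly (p : {poly rat}) : 0 < p.[1 / 2] ->
  positive_at_half (tofrac p).
Proof.
by move=> p0; exists p, 1; rewrite hornerC rmorph1 divr1.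
Qed.

Lemma tofrac_neq0 (d : {poly rat}) : 0 < d.[1 / 2] -> tofrac d != 0.
Proof.
move=> d0; rewrite tofrac_eq0; apply: contraTneq d0 => ->.
by rewrite horner0 ltxx.
Qed.

Lemma positive_add x y :
  positive_at_half x -> positive_at_half y -> positive_at_half (x + y).
Proof.
move=> [p [d [p0 d0 ->]]] [q [e [q0 e0 ->]]].
exists (p * e + q * d), (d * e); rewrite hornerD !hornerM; split.
- by rewrite addr_gt0 ?mulr_gt0.
- by rewrite mulr_gt0.
by rewrite addf_div ?tofrac_neq0 // rmorphD !rmorphM.
Qed.

Lemma positive_mul x y :
  positive_at_half x -> positive_at_half y -> positive_at_half (x * y).
Proof.
move=> [p [d [p0 d0 ->]]] [q [e [q0 e0 ->]]].
exists (p * q), (d * e); rewrite !hornerM; split; try exact: mulr_gt0.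
by rewrite mulf_div !rmorphM.
Qed.

Lemma positive_0 : ~ positive_at_half 0.
Proof.
move=> [p [d [p0 d0 /esym/eqP]]].
by rewrite mulf_eq0 invr_eq0 (negPf (tofrac_neq0 p0)) (negPf (tofrac_neq0 d0)).
Qed.

Lemma map_elementary n (K : fieldType) nu :
  map_mpoly intr (elementary n int nu) = elementary n K nu.
Proof.
rewrite /elementary rmorph_prod; apply: eq_bigr => k _.
rewrite /mesym rmorph_sum; apply: eq_bigr => A _.
by rewrite rmorph_prod; apply: eq_bigr => i _; rewrite /= map_mpolyX.
Qed.

Theorem theorem4p5 (n : nat) (hn : (0 < n)%N) (lam : weak_comp n) :
  exists nu : seq nat,
    is_partition nu /\
    forall sigma : 'S_n,
      macdonald sigma (weak_std lam) 1 tvar != 0 /\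
      tofrac (macdonald sigma lam 1 tvar)
        / tofrac (macdonald sigma (weak_std lam) 1 tvar)
      = tofrac (map_mpoly intr (elementary n int nu)).
Proof.
have dt k : 1 - tvar ^+ k.+1 != 0 by have := tvar_denominator k; rewrite mul1r.
have t0 : tvar != 0 by rewrite tofrac_eq0 polyX_eq0.
have [nu [nu0 nuE]] := macdonald_weak_std t0 dt lam.
(* Sorting the parts gives a partition and does not change the product. *)
exists (sort geq nu); split.
  rewrite /is_partition mem_sort nu0 andbT.
  by apply: sort_sorted => x y /=; rewrite leq_total.
move=> sigma.
have nz : macdonald sigma (weak_std lam) 1 tvar != 0.
  apply: (macdonald_neq0 (P := positive_at_half)).
  - rewrite -(rmorph1 (@tofrac {poly rat})).
    by apply: positive_poly; rewrite hornerC.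
  - exact: positive_add.
  - exact: positive_mul.
  - by apply: positive_poly; rewrite hornerX.
  - move=> k; rewrite -rmorphXn -(rmorph1 (@tofrac {poly rat})) -!rmorphB.
    have pos (j : nat) : 0 < (1 - ('X : {poly rat}) ^+ j.+1).[1 / 2].
      by rewrite !hornerE subr_gt0 exprn_ilt1.
    by apply: positive_frac; [apply: (pos 0%N) | apply: pos].
  exact: positive_0.
split=> //; rewrite nuE map_elementary rmorphM mulfK ?tofrac_eq0 //.
by congr tofrac; apply: perm_big; rewrite perm_sym perm_sort.
Qed.
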